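(* Let $\ell_1\neq\ell_2$ be odd prime numbers and let $p$ be a prime number with $p\nmid 2\ell_1\ell_2$. Let $m,n$ be positive integers such that $\mathcal{H}_{\ell_1}$ is maximal over $\mathbb{F}_{p^{2m}}$ and $\mathcal{H}_{\ell_2}$ is maximal over $\mathbb{F}_{p^{2n}}$. If $\mathcal{H}_{\ell_1\ell_2}$ is maximal over some finite field of characteristic $p$, then $n$ and $m$ have equal $2$-adic valuation.
   Context: For $d\in\mathbb{Z}_{>0}$ the $d$-th Chebyshev polynomial $\Phi_d(x)\in\mathbb{Z}[x]$ is the unique polynomial such that $\Phi_d(x+\frac1x)=x^d+\frac1{x^d}$ in $\mathbb{Z}[x,x^{-1}]$. For a prime $p$, $\varphi_d(x)\in\mathbb{F}_p[x]$ denotes the reduction of $\Phi_d(x)$ modulo $p$. For $p\nmid 2d$, $\varphi_d(x)$ is separable, and $\mathcal{H}_d$ denotes the complete, regular, absolutely irreducible (hyperelliptic) curve over $\mathbb{F}_p$ (and, by base change, over extensions of $\mathbb{F}_p$) given by the affine equation $y^2=\varphi_d(x)$; its genus is $g(\mathcal{H}_d)=\lfloor (d-1)/2\rfloor$. For $q$ a power of $p$, the curve $\mathcal{H}_d$ is called maximal over $\mathbb{F}_{q^2}$ if $\#\mathcal{H}_d(\mathbb{F}_{q^2})=q^2+1+2g(\mathcal{H}_d)q$. ''Maximal over some finite field of characteristic $p$'' means maximal over $\mathbb{F}_{q^2}$ for some power $q$ of $p$. *)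

(* Defs.v *)
From HB Require Import structures.
From mathcomp Require Import all_boot all_order all_algebra all_field.
From mathcomp Require Import ring.

Set Implicit Arguments.
Unset Strict Implicit.
Unset Printing Implicit Defensive.

Import GRing.Theory.
Local Open Scope ring_scope.

Notation "x %:F" := (tofrac x) : ring_scope.

(* The identity Phi(x + 1/x) = x^d + 1/x^d is stated in Q(x), the fraction
   field of Z[x], which contains Z[x, 1/x]. *)
Definition is_chebyshev (d : nat) (P : {poly int}) : Prop :=
  let x : {fraction {poly int}} := 'X%:F in
  (map_poly intr P).[x + x^-1] = x ^+ d + x ^- d.

Lemma chebyshev_exists (d : nat) : {P : {poly int} | is_chebyshev d P}.
Proof.
suff [[P hP] _] : {P : {poly int} | is_chebyshev d P} *
                  {P : {poly int} | is_chebyshev d.+1 P} by exists P.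
elim: d => [|d [[P hP] [Q hQ]]].
  split; first by exists 2%:P; rewrite /is_chebyshev map_polyC hornerC expr0 invr1.
  by exists 'X; rewrite /is_chebyshev map_polyX hornerX !expr1.
split; first by exists Q.
exists ('X * Q - P); move: hP hQ; rewrite /is_chebyshev.
set x := 'X%:F => hP hQ.
have x0 : x != 0 by rewrite /x tofrac_eq0 polyX_eq0.
rewrite rmorphB rmorphM /= map_polyX !hornerE hP hQ.
have xV := mulfV x0; rewrite -!exprVn !exprS.
move: (x^-1) (x ^+ d) (x^-1 ^+ d) xV => y A B xV.
transitivity (x * (x * A) + y * (y * B) + (x * y - 1) * (A + B)); first by ring.
by rewrite xV subrr mul0r addr0.
Qed.

Lemma chebyshev_unique (d : nat) (P Q : {poly int}) :
  is_chebyshev d P -> is_chebyshev d Q -> P = Q.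
Proof.
rewrite /is_chebyshev; set x := 'X%:F => hP hQ.
have x0 : x != 0 by rewrite /x tofrac_eq0 polyX_eq0.
apply/eqP; rewrite -subr_eq0; apply/negP => /negP R0.
have: (map_poly intr (P - Q)).[x + x^-1] = 0.
  by rewrite rmorphB /= !hornerE hP hQ subrr.
move: (P - Q) R0 => R R0 hR {P Q hP hQ}.
set n := (size R).-1.
have sR : size R = n.+1 by rewrite prednK // lt0n size_poly_eq0.
pose S : {poly int} := \sum_(i < n.+1) (R`_i)%:P * (('X^2 + 1) ^+ i * 'X^(n - i)).
have S0 : S = 0.
  apply/eqP; rewrite -(tofrac_eq0 S); apply/eqP.
  transitivity (x ^+ n * (map_poly intr R).[x + x^-1]); last by rewrite hR mulr0.
  have sR' : (size (map_poly intr R : {poly {fraction {poly int}}}) <= n.+1)%N.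
    by rewrite -sR size_poly.
  rewrite (horner_coef_wide _ sR') mulr_sumr rmorph_sum /=.
  apply: eq_bigr => i _.
  rewrite coef_map /= !rmorphM /= !rmorphXn /= rmorphD rmorph1 rmorphXn /=.
  have -> : ((R`_i)%:P)%:F = (R`_i)%:~R by rewrite -(rmorph_int (@tofrac _)) -(rmorph_int polyC) /= intz.
  rewrite -/x [RHS]mulrCA; congr (_ * _).
  have -> : x ^+ 2 + 1 = x * (x + x^-1) by rewrite mulrDr mulfV.
  rewrite exprMn mulrAC -exprD subnKC //; exact: (ltn_ord i).
have := congr1 (fun p : {poly int} => p.[0]) S0.
rewrite /S horner_sum big_ord_recr /= big1 => [|i _].
  rewrite add0r subnn !hornerE /= expr1n !mulr1 => h.
  by move: R0; rewrite -lead_coef_eq0 /lead_coef -/n h eqxx.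
by rewrite !hornerE expr0n /= subn_eq0 leqNgt ltn_ord /= !mulr0.
Qed.

Definition Chebyshev (d : nat) : {poly int} := sval (chebyshev_exists d).

Lemma ChebyshevP (d : nat) : is_chebyshev d (Chebyshev d).
Proof. exact: svalP. Qed.

(* Over R of characteristic p this is the image in R[x] of the reduction
   phi_d of Phi_d in F_p[x]. *)
Definition chebyshev_poly (R : nzRingType) (d : nat) : {poly R} :=
  map_poly intr (Chebyshev d).

Definition genus (d : nat) : nat := (d.-1)./2.

Section Curve.
Variables (K : finFieldType) (d : nat).

(* The complete regular model H_d of y^2 = phi_d(x) is the closed subscheme
     Y^2 = \sum_i (phi_d)_i X^i Z^(2g+2-i)
   of the weighted projective plane P(1, g+1, 1), with g the genus: its charts
   Z = 1 and X = 1 are y^2 = phi_d(x) and w^2 = z^(2g+2) phi_d(1/z), glued along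
   z = 1/x, w = y/x^(g+1).  For p not dividing 2d, phi_d is separable, and its
   degree d is 2g+1 or 2g+2, so both charts are smooth.  Coordinates are listed
   as (X, Y, Z). *)
Definition hyp_form (X Z : K) : K :=
  \sum_(i < d.+1) (chebyshev_poly K d)`_i * X ^+ i * Z ^+ ((genus d).*2.+2 - i).

Definition hyp_cone : {set K * K * K} :=
  [set P | (P != (0, 0, 0)) && (P.1.2 ^+ 2 == hyp_form P.1.1 P.2)].

Definition wproj_class (P : K * K * K) : {set K * K * K} :=
  [set (t * P.1.1, t ^+ (genus d).+1 * P.1.2, t * P.2) | t : K & t != 0].

(* The K-rational points.  On the curve X and Z do not both vanish and have
   weight 1, so every K-rational point has a representative over K, unique up
   to scaling by K^*. *)
Definition hyp_points : {set {set K * K * K}} :=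
  [set wproj_class P | P in hyp_cone].

Definition maximal_over (q : nat) : Prop :=
  #|K| = (q ^ 2)%N /\ #|hyp_points| = (q ^ 2 + 1 + 2 * genus d * q)%N.

End Curve.

(* Main.v *)
Require Import Defs.
From mathcomp Require Import all_boot all_order all_algebra all_field.
From mathcomp Require Import all_solvable ring zify.

(** The proof is elementary.  Let [F] be a finite field of order [Q = q ^ 2] with
    [q = p ^ m], let [chi] be its quadratic character and let [d > 1] be odd.
    The curve of degree [d] has [Q + 1 + S] rational points, where [S] is the sum
    of [chi (phi_d x)] over [F], so it is maximal when [S = (d - 1) * q].

    Writing [x = t + 1/t], with [t] on one of the tori [t ^ (Q - 1) = 1] and
    [t ^ (Q + 1) = 1], turns [2 * S] into the sum of [chi (t ^ d + t ^ -d)] over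
    both tori ([double_sum_base]).  On the torus of order [N] this sum is
    [e * U (N / e)], where [e = gcd (d, N)] and [U M] is the sum of
    [chi (t + 1/t)] over the [M]-th roots of unity ([sum_unity_expr]).  A second
    moment computation yields the square-root bound [U M <= 2 * q]
    ([torus_sum_bound]), and with it maximality forces [d] to divide [Q - 1] or
    [Q + 1].  Let [A = U (Q - 1)].  As [U (Q - 1) + U (Q + 1) = 0], reducing
    [2 * S] modulo [d] shows ([maximal_congruence]) that either [d] divides
    [Q - 1] and [A = 2 * q] modulo [d], or [d] divides [Q + 1] and [A = -2 * q]
    modulo [d].

    Up to sign, [A] is the trace of Frobenius of [y ^ 2 = x ^ 3 + x], which has
    complex multiplication by [Z[i]], and [A = - (w ^ m + w' ^ m)] with
    [w * w' = p ^ 2] and [w, w'] depending only on [p] ([cm_sum_trace]).  This is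
    obtained from Jacobsthal's identity [A ^ 2 + B ^ 2 = 4 * Q], the congruence
    [A = 6] modulo 8, the fact that [p] does not divide [A] if [p = 1] modulo 4,
    and the uniqueness of primitive representations of a power of [p] as a sum
    of two squares.

    Let [l] be a prime divisor of [d] and read everything in a field of
    characteristic [l].  In the first case [w ^ m = - q] and [q ^ 2 = 1], in the
    second [w ^ m = q] and [q ^ 2 = -1]; so [(w * p) ^ m = -1] in both
    ([maximal_exponent]).  The exponents [m] with this property all have the same
    2-adic valuation.  Since [l1] and [l2] divide [l1 * l2], the valuations of
    both [m] and [n] are that of any exponent over which the curve of degree
    [l1 * l2] is maximal. *)

Set Implicit Arguments.
Unset Strict Implicit.
Unset Printing Implicit Defensive.

Import Order.TTheory GRing.Theory Num.Theory.

(** * The quadratic character *)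

Section QuadraticCharacter.
Local Open Scope ring_scope.

(** Euler's criterion as a definition over any field: with [Q] the order of a
    finite field [F], it gives the quadratic character of [F] on the image of
    [F] in an extension, without reference to that image. *)
Definition qchar (Q : nat) (R : fieldType) (x : R) : int :=
  if x == 0 then 0 else if x ^+ Q.-1./2 == 1 then 1 else -1.

Lemma qchar_map (Q : nat) (R S : fieldType) (f : {rmorphism R -> S}) (x : R) :
  qchar Q (f x) = qchar Q x.
Proof. by rewrite /qchar fmorph_eq0 -rmorphXn fmorph_eq1. Qed.

Lemma qchar0 (Q : nat) (R : fieldType) : qchar Q (0 : R) = 0.
Proof. by rewrite /qchar eqxx. Qed.

Lemma card_pred_gt0 (F : finFieldType) : (0 < #|F|.-1)%N.
Proof. by rewrite -subn1 subn_gt0 finNzRing_gt1. Qed.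

Lemma expf_pred (F : finFieldType) (x : F) : x != 0 -> x ^+ #|F|.-1 = 1.
Proof.
move=> x0; apply: (mulfI x0); rewrite -exprS prednK ?expf_card ?mulr1 //.
by rewrite ltnW // finNzRing_gt1.
Qed.

Lemma finField_prim_root (F : finFieldType) :
  exists z : F, #|F|.-1.-primitive_root z.
Proof.
have F1 := card_pred_gt0 F.
pose rs := enum (predC1 (0 : F)).
have /hasP[z _ zP] : has #|F|.-1.-primitive_root rs.
  apply: has_prim_root => //; last by rewrite -cardE cardC1.
  - apply/allP => x; rewrite mem_enum inE => x0.
    by apply/unity_rootP/expf_pred.
  - exact: enum_uniq.
by exists z.
Qed.

Variable F : finFieldType.
Local Notation Q := #|F|.
Local Notation chi := (@qchar Q F).
Hypothesis oddQ : odd Q.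

Lemma halfQ : Q.-1 = (Q.-1./2).*2.
Proof.
by rewrite even_halfK // -subn1 oddB ?oddQ // ltnW // finNzRing_gt1.
Qed.

Lemma halfQ_gt0 : (0 < Q.-1./2)%N.
Proof.
by have := card_pred_gt0 F; rewrite {1}halfQ double_gt0.
Qed.

Lemma neq1N1 : (1 : F) != -1.
Proof.
have [z zP] := finField_prim_root F.
have h : z ^+ Q.-1./2 != 1.
  rewrite -(prim_order_dvd zP) gtnNdvd ?halfQ_gt0 // [X in (_ < X)%N]halfQ -addnn.
  by rewrite -[X in (X < _)%N]addn0 ltn_add2l halfQ_gt0.
have : z ^+ Q.-1./2 ^+ 2 == 1.
  by rewrite -exprM muln2 -halfQ prim_expr_order.
by rewrite sqrf_eq1 (negPf h) /= => /eqP zh; rewrite eq_sym -zh.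
Qed.

Lemma natf2_neq0 : (2 : F) != 0.
Proof. by rewrite -[2]/(1 + 1) addr_eq0 neq1N1. Qed.

Lemma expf_half (x : F) : x != 0 ->
  x ^+ Q.-1./2 = if x ^+ Q.-1./2 == 1 then 1 else -1.
Proof.
move=> x0; case: ifPn => [/eqP //|xh]; apply/eqP.
have : x ^+ Q.-1./2 ^+ 2 == 1 by rewrite -exprM muln2 -halfQ expf_pred.
by rewrite sqrf_eq1 (negPf xh).
Qed.

Lemma qcharE (x : F) : (chi x)%:~R = x ^+ Q.-1./2.
Proof.
rewrite /qchar; have [->|x0] := eqVneq x 0.
  by rewrite expr0n eqn0Ngt halfQ_gt0.
by rewrite [RHS]expf_half //; case: ifP.
Qed.

Lemma qchar_cases (x : F) : [\/ chi x = 0, chi x = 1 | chi x = -1].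
Proof.
rewrite /qchar; case: eqP => _; first by constructor 1.
by case: eqP => _; [constructor 2 | constructor 3].
Qed.

Lemma qcharM (x y : F) : chi (x * y) = chi x * chi y.
Proof.
have := qcharE (x * y); rewrite exprMn -!qcharE -intrM.
have n1 := neq1N1; have n1' : (-1 : F) != 1 by rewrite eq_sym.
have n0 := oner_neq0 F; have n0' : (-1 : F) != 0 by rewrite oppr_eq0.
have n2 : (0 : F) != 1 by rewrite eq_sym.
have n2' : (0 : F) != -1 by rewrite eq_sym.
by case: (qchar_cases (x * y)) => ->; case: (qchar_cases x) => ->;
  case: (qchar_cases y) => -> //= /eqP;
  rewrite ?(mulr0, mul0r, mulr1, mul1r, mulrNN) ?rmorphN ?rmorph1 ?rmorph0
    ?(negPf n1) ?(negPf n1') ?(negPf n0) ?(negPf n0') ?(negPf n2) ?(negPf n2').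
Qed.

Lemma qchar_eq0 (x : F) : (chi x == 0) = (x == 0).
Proof. by rewrite /qchar; case: (x == 0) => //; case: ifP. Qed.

Lemma qchar_sq (x : F) : chi x ^+ 2 = (x != 0)%:R.
Proof. by rewrite /qchar; case: (x == 0) => //=; case: ifP. Qed.

Lemma qcharX2 (x : F) : x != 0 -> chi (x ^+ 2) = 1.
Proof. by move=> x0; rewrite expr2 qcharM -expr2 qchar_sq x0. Qed.

Lemma qcharV (x : F) : chi x^-1 = chi x.
Proof.
have [->|x0] := eqVneq x 0; first by rewrite invr0.
have -> : x^-1 = x * (x^-1 ^+ 2) by rewrite expr2 mulrA mulfV ?mul1r.
by rewrite qcharM qcharX2 ?invr_eq0 ?mulr1.
Qed.

Lemma qchar_sqrtP (x : F) : x != 0 ->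
  reflect (exists y, y ^+ 2 = x) (chi x == 1).
Proof.
move=> x0; apply: (iffP eqP) => [|[y yx]]; last first.
  by rewrite -yx qcharX2 //; apply: contraNneq x0 => y0; rewrite -yx y0 expr0n.
have [z zP] := finField_prim_root F.
have [i ->] := prim_rootP zP (expf_pred x0).
rewrite /qchar -exprM; case: ifP => // _; case: ifP => // + _.
rewrite -(prim_order_dvd zP) [X in (X %| _)%N]halfQ -muln2 [(i * _)%N]mulnC.
rewrite dvdn_pmul2l ?halfQ_gt0 // => /dvdnP[j ->].
by exists (z ^+ j); rewrite -exprM.
Qed.

Lemma qchar_nonsquare : exists g : F, chi g = -1.
Proof.
have [z zP] := finField_prim_root F; exists z.
have z0 : z != 0 by rewrite (prim_root_eq0 zP) -lt0n (prim_order_gt0 zP).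
rewrite /qchar (negPf z0) -(prim_order_dvd zP) gtnNdvd ?halfQ_gt0 //.
rewrite [X in (_ < X)%N]halfQ -addnn -[X in (X < _)%N]addn0.
by rewrite ltn_add2l halfQ_gt0.
Qed.

Lemma sum_qchar : \sum_x chi x = 0.
Proof.
have [g gN] := qchar_nonsquare.
have g0 : g != 0 by rewrite -qchar_eq0 gN.
set S := \sum_x _; suff : S = - S by lia.
rewrite {1}/S (reindex (fun x => g * x)) /=; last first.
  by exists (fun x => g^-1 * x) => x _; [rewrite mulKf|rewrite mulVKf].
by rewrite -sumrN; apply: eq_bigr => x _; rewrite qcharM gN mulN1r.
Qed.

Lemma card_sqrt (x : F) : #|[pred y | y ^+ 2 == x]|%:R = 1 + chi x.
Proof.
have [->|x0] := eqVneq x 0.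
  rewrite qchar0 addr0 (eq_card (B := pred1 0)) ?card1 // => y.
  by rewrite !inE sqrf_eq0.
have [xC|xN] := eqVneq (chi x) 1.
  have [y yx] : exists y, y ^+ 2 = x by apply/(qchar_sqrtP x0)/eqP.
  have y0 : y != 0 by apply: contraNneq x0 => y0; rewrite -yx y0 expr0n.
  rewrite (eq_card (B := pred2 y (- y))) => [|w]; last first.
    by rewrite !inE -yx eqf_sqr.
  have yN : y != - y by rewrite -addr_eq0 -mulr2n -mulr_natr mulf_neq0 ?natf2_neq0.
  by rewrite card2 yN -yx qcharX2.
rewrite eq_card0 => [|y]; last first.
  rewrite !inE; apply: contra_neqF xN => /eqP yx.
  by apply/eqP/(qchar_sqrtP x0); exists y.
by case: (qchar_cases x) (qchar_eq0 x) xN => ->; rewrite (negPf x0).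
Qed.

End QuadraticCharacter.

(** * Chebyshev polynomials *)

Section ChebyshevPolynomials.
Local Open Scope ring_scope.

Lemma Chebyshev0 : Chebyshev 0 = 2%:P.
Proof.
apply: (chebyshev_unique (ChebyshevP 0)).
by rewrite /is_chebyshev map_polyC hornerC expr0 invr1.
Qed.

Lemma Chebyshev1 : Chebyshev 1 = 'X.
Proof.
apply: (chebyshev_unique (ChebyshevP 1)).
by rewrite /is_chebyshev map_polyX hornerX !expr1.
Qed.

Lemma addf_exprV_rec (R : fieldType) (t : R) (d : nat) : t != 0 ->
  t ^+ d.+2 + t ^- d.+2
    = (t + t^-1) * (t ^+ d.+1 + t ^- d.+1) - (t ^+ d + t ^- d).
Proof.
move=> t0; have tV := mulfV t0; rewrite -!exprVn !exprS.
move: (t^-1) (t ^+ d) (t^-1 ^+ d) tV => u a b tu.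
apply/eqP; rewrite -subr_eq0; apply/eqP.
transitivity ((1 - t * u) * (a + b)); last by rewrite tu subrr mul0r.
by ring.
Qed.

Lemma ChebyshevSS (d : nat) :
  Chebyshev d.+2 = 'X * Chebyshev d.+1 - Chebyshev d.
Proof.
apply: (chebyshev_unique (ChebyshevP d.+2)).
have := (ChebyshevP d, ChebyshevP d.+1); rewrite /is_chebyshev => -[hd hd1].
rewrite rmorphB rmorphM /= map_polyX !hornerE hd hd1 addf_exprV_rec //.
by rewrite tofrac_eq0 polyX_eq0.
Qed.

Lemma size_Chebyshev (d : nat) : (size (Chebyshev d) <= d.+1)%N.
Proof.
suff [] : (size (Chebyshev d) <= d.+1)%N /\ (size (Chebyshev d.+1) <= d.+2)%N by [].
elim: d => [|d [hd hd1]].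
  by rewrite Chebyshev0 Chebyshev1 size_polyX size_polyC.
split=> //; rewrite ChebyshevSS (leq_trans (size_polyD _ _)) // geq_max size_polyN.
rewrite (leq_trans hd) ?andbT; last by rewrite ltnW.
by rewrite (leq_trans (size_polyMleq _ _)) // size_polyX.
Qed.

Lemma horner_chebyshev_poly (R : fieldType) (d : nat) (t : R) : t != 0 ->
  (chebyshev_poly R d).[t + t^-1] = t ^+ d + t ^- d.
Proof.
move=> t0; suff [] : (chebyshev_poly R d).[t + t^-1] = t ^+ d + t ^- d /\
  (chebyshev_poly R d.+1).[t + t^-1] = t ^+ d.+1 + t ^- d.+1 by [].
rewrite /chebyshev_poly; elim: d => [|d [hd hd1]].
  by rewrite Chebyshev0 Chebyshev1 map_polyC map_polyX !hornerE expr0 invr1 !expr1.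
split=> //; rewrite ChebyshevSS rmorphB rmorphM /= map_polyX !hornerE hd hd1.
by rewrite addf_exprV_rec.
Qed.

Lemma map_chebyshev_poly (R S : fieldType) (f : {rmorphism R -> S}) (d : nat) :
  map_poly f (chebyshev_poly R d) = chebyshev_poly S d.
Proof.
rewrite /chebyshev_poly -map_poly_comp; apply: eq_map_poly => n /=.
by rewrite rmorph_int.
Qed.

End ChebyshevPolynomials.

(** * Points of the hyperelliptic curve *)

Section PointCount.
Local Open Scope ring_scope.

Variables (K : finFieldType) (d : nat).
Hypothesis oddd : odd d.

Lemma genus_odd : ((genus d).*2 = d.-1)%N.
Proof. by rewrite even_halfK //; case: d oddd. Qed.

Lemma hyp_formE (X Z : K) : Z != 0 ->
  hyp_form d X Z = Z ^+ d.+1 * (chebyshev_poly K d).[X / Z].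
Proof.
move=> Z0; have d0 : (0 < d)%N by case: d oddd.
rewrite /hyp_form genus_odd prednK //.
rewrite (@horner_coef_wide _ d.+1); last first.
  by rewrite (leq_trans (size_poly _ _)) // size_Chebyshev.
rewrite mulr_sumr; apply: eq_bigr => i _.
have -> : Z ^+ d.+1 = Z ^+ i * Z ^+ (d.+1 - i).
  by rewrite -exprD subnKC // ltnW.
rewrite exprMn exprVn.
have := mulfV (expf_neq0 i Z0); set a := Z ^+ i; set b := a^-1 => ab.
transitivity (a * b * (X ^+ i * Z ^+ (d.+1 - i) * (chebyshev_poly K d)`_i)).
  by rewrite ab mul1r; ring.
by ring.
Qed.

Lemma hyp_form0 (X : K) : hyp_form d X 0 = 0.
Proof.
rewrite /hyp_form big1 // => i _; rewrite [0 ^+ _]expr0n subn_eq0.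
have -> : (genus d).*2.+2 = d.+1 by rewrite genus_odd; case: d oddd.
by rewrite leqNgt ltn_ord mulr0.
Qed.

Definition wscale (t : K) (P : K * K * K) : K * K * K :=
  (t * P.1.1, t ^+ (genus d).+1 * P.1.2, t * P.2).

Lemma wproj_classP (P P' : K * K * K) :
  reflect (exists2 t, t != 0 & P' = wscale t P) (P' \in wproj_class d P).
Proof.
apply: (iffP imsetP) => [[t ht ->]|[t t0 ->]]; exists t => //.
  by move: ht; rewrite inE.
by rewrite inE.
Qed.

Lemma wproj_class_refl (P : K * K * K) : P \in wproj_class d P.
Proof.
apply/wproj_classP; exists 1; first exact: oner_neq0.
by case: P => [[X Y] Z]; rewrite /wscale /= expr1n !mul1r.
Qed.

Lemma wproj_class_wscale (t : K) (P : K * K * K) : t != 0 ->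
  wproj_class d (wscale t P) = wproj_class d P.
Proof.
move=> t0; apply/setP => P'; apply/wproj_classP/wproj_classP => -[s s0 ->].
  exists (s * t); first by rewrite mulf_neq0.
  by rewrite /wscale /= exprMn !mulrA.
exists (s / t); first by rewrite mulf_neq0 ?invr_eq0.
by rewrite /wscale /= !mulrA -exprMn mulfVK.
Qed.

(** One representative for each rational point: the affine points in the chart
    [Z = 1], and the single point at infinity of a curve of odd degree. *)
Definition hyp_reps : {set K * K * K} :=
  [set P | (P.1.2 ^+ 2 == hyp_form d P.1.1 P.2) && (P.2 == 1)] :|: [set (1, 0, 0)].

Lemma hyp_points_reps : hyp_points K d = wproj_class d @: hyp_reps.
Proof.
apply/setP => C; apply/imsetP/imsetP => -[P PP ->].
  move: PP; rewrite inE; case: P => [[X Y] Z] /= /andP[P0 /eqP PP].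
  have [Z0|Z0] := eqVneq Z 0.
    move: PP P0; rewrite Z0 hyp_form0 => /eqP; rewrite sqrf_eq0 => /eqP-> X0.
    have {}X0 : X != 0 by apply: contraNneq X0 => ->.
    exists (1, 0, 0); first by rewrite !inE eqxx orbT.
    by rewrite -(wproj_class_wscale (1, 0, 0) X0) /wscale /= mulr1 !mulr0.
  exists (wscale Z^-1 (X, Y, Z)); last by rewrite wproj_class_wscale ?invr_eq0.
  rewrite !inE /= mulVf // eqxx andbT; apply/orP; left; apply/eqP.
  rewrite hyp_formE ?oner_neq0 // expr1n mul1r divr1 exprMn PP hyp_formE //.
  rewrite mulrA -exprM muln2 doubleS genus_odd.
  have -> : d.-1.+2 = d.+1 by case: d oddd.
  by rewrite exprVn mulVf ?mul1r 1?mulrC // expf_neq0.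
exists P => //; move: PP; rewrite !inE => /orP[/andP[PP /eqP P1]|/eqP->] /=.
  rewrite PP andbT; case: P P1 {PP} => [[X Y] Z] /= ->.
  by rewrite !xpair_eqE oner_eq0 andbF.
by rewrite hyp_form0 !xpair_eqE oner_eq0 /= expr0n.
Qed.

Lemma wproj_class_inj : {in hyp_reps &, injective (wproj_class d)}.
Proof.
move=> P P' PP PP' hPP'; have := wproj_class_refl P; rewrite hPP'.
move=> /wproj_classP[t t0 Pt]; move: PP PP'; rewrite !inE {hPP'}Pt.
case: P' => [[X Y] Z] /=.
move=> /orP[/andP[_ /eqP tZ]|/eqP[tX tY tZ]] /orP[/andP[_ /eqP Z1]|/eqP[X1 Y0 Z0]].
- by move: tZ; rewrite /wscale Z1 mulr1 => -> /=; rewrite expr1n !mul1r.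
- by move: tZ; rewrite Z0 mulr0 => /eqP; rewrite eq_sym oner_eq0.
- by move: tZ; rewrite Z1 mulr1 => /eqP; rewrite (negPf t0).
- by move: tX; rewrite /wscale X1 Y0 Z0 mulr1 /= => ->; rewrite expr1n !mul1r.
Qed.

Hypothesis oddK : odd #|K|.

Lemma card_hyp_points :
  #|hyp_points K d|%:R
    = #|K|%:R + 1 + \sum_(x : K) qchar #|K| (chebyshev_poly K d).[x].
Proof.
rewrite hyp_points_reps card_in_imset; last exact: wproj_class_inj.
rewrite /hyp_reps setUC cardsU1 !inE /=.
rewrite [0 == 1]eq_sym oner_eq0 andbF add1n -natr1.
rewrite addrAC; congr (_ + 1).
transitivity (\sum_(x : K) (1 + qchar #|K| (chebyshev_poly K d).[x])); last first.
  by rewrite big_split /= sumr_const.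
pose aff := [set xy : K * K | xy.2 ^+ 2 == (chebyshev_poly K d).[xy.1]].
have -> : [set P : K * K * K | (P.1.2 ^+ 2 == hyp_form d P.1.1 P.2) & P.2 == 1]
    = [set (xy, 1) | xy in aff].
  apply/setP => -[[X Y] Z]; rewrite inE /=.
  apply/andP/imsetP => [[XY /eqP Z1]|[[x y]]].
    exists (X, Y); last by rewrite Z1.
    by move: XY; rewrite inE Z1 hyp_formE ?oner_neq0 // expr1n mul1r divr1.
  rewrite inE => xy [-> -> ->]; rewrite eqxx.
  by rewrite hyp_formE ?oner_neq0 // expr1n mul1r divr1.
rewrite card_imset; last by move=> xy xy' [].
rewrite -sum1dep_card -(pair_big_dep xpredT
  (fun x y => y ^+ 2 == (chebyshev_poly K d).[x]) (fun _ _ => 1%N)) /=.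
rewrite natr_sum; apply: eq_bigr => x _.
by rewrite sum1_card card_sqrt.
Qed.

Lemma maximal_over_sum (q : nat) : maximal_over K d q ->
  #|K| = (q ^ 2)%N /\
  \sum_(x : K) qchar #|K| (chebyshev_poly K d).[x] = (d.-1 * q)%:R.
Proof.
move=> [cardK hpts]; split => //; have := card_hyp_points.
rewrite hpts cardK mul2n genus_odd !natrD /=; set S := \sum_x _; lia.
Qed.

End PointCount.

(** * Sums over roots of unity *)

Section RootsOfUnity.
Local Open Scope ring_scope.

Lemma sum_unity_prim (L : finFieldType) (N : nat) (z : L) (f : L -> int) :
  N.-primitive_root z -> \sum_(y : L | y ^+ N == 1) f y = \sum_(i < N) f (z ^+ i).
Proof.
move=> zP; have N0 := prim_order_gt0 zP.
rewrite -[RHS](big_map (fun i : 'I_N => z ^+ i) predT f).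
rewrite [RHS]big_uniq /=; last first.
  rewrite map_inj_in_uniq ?index_enum_uniq // => i j _ _ /eqP.
  by rewrite (eq_prim_root_expr zP) !modn_small // => /eqP/val_inj.
apply: eq_bigl => y; apply/idP/mapP => [/eqP yN|[i _ ->]].
  by have [i ->] := prim_rootP zP yN; exists i; rewrite ?mem_index_enum.
by rewrite exprAC (prim_expr_order zP) expr1n.
Qed.

Lemma sum_ord_periodic (g : nat -> int) (e n : nat) :
  (forall i, g (n + i)%N = g i) ->
  \sum_(i < e * n) g i = e%:R * \sum_(i < n) g i.
Proof.
move=> gP; elim: e => [|e IHe]; first by rewrite mul0n big_ord0 mul0r.
rewrite mulSn big_split_ord /= -[e.+1]add1n natrD mulrDl mul1r -IHe.
by congr (_ + _); apply: eq_bigr => i _; rewrite gP.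
Qed.

(** If [z] is a primitive [N]-th root of unity, then [z ^+ d] is a primitive one
    of order [N / gcd (d, N)], and its powers are run through [gcd (d, N)]
    times. *)
Lemma sum_unity_expr (L : finFieldType) (N d : nat) (z : L) (f : L -> int) :
  N.-primitive_root z ->
  \sum_(y : L | y ^+ N == 1) f (y ^+ d)
    = (gcdn d N)%:R * \sum_(y : L | y ^+ (N %/ gcdn d N) == 1) f y.
Proof.
move=> zP; have N0 := prim_order_gt0 zP.
rewrite (sum_unity_prim (fun y => f (y ^+ d)) zP).
rewrite (sum_unity_prim f (exp_prim_root zP d)).
rewrite -(@sum_ord_periodic (fun i => f (z ^+ d ^+ i))) => [|i].
  rewrite mulnC divnK ?dvdn_gcdr //.
  by apply: eq_bigr => i _; rewrite -!exprM mulnC.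
by rewrite exprD (prim_expr_order (exp_prim_root zP d)) mul1r.
Qed.

End RootsOfUnity.

(** * The two tori over a finite field *)

Section ToriInExtension.
Local Open Scope ring_scope.

(** Meant for [M] dividing [Q - 1] or [Q + 1]; then every [y + y^-1] in the sum
    lies in the field with [Q] elements. *)
Definition torus_sum (Q : nat) (L : finFieldType) (M : nat) : int :=
  \sum_(y : L | y ^+ M == 1) qchar Q (y + y^-1).

(** The splitting field of the product of all [t ^+ 2 - x * t + 1]. *)
Lemma reciprocal_ext (F : finFieldType) :
  exists (L : finFieldType) (iota : {rmorphism F -> L}),
  forall x : F, exists2 t : L, t != 0 & t + t^-1 = iota x.
Proof.
pose q (x : F) : {poly F} := 'X^2 - x *: 'X + 1.
have sq (x : F) : (size (- (x *: 'X) + 1 : {poly F})%R <= 2)%N.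
  rewrite (leq_trans (size_polyD _ _)) // geq_max size_polyN size_poly1.
  by rewrite (leq_trans (size_scale_leq _ _)) ?size_polyX.
have size_q x : size (q x) = 3%N.
  by rewrite /q -addrA size_polyDl size_polyXn // ltnS.
have q0 x : q x != 0 by rewrite -size_poly_eq0 size_q.
have p0 : \prod_x q x != 0 by apply/prodf_neq0.
have [L [rs prs _]] := FinSplittingFieldFor p0.
exists (finvect_type L), (in_alg L) => x.
have : map_poly (in_alg L) (q x) %| \prod_(z <- rs) ('X - z%:P).
  by rewrite -(eqp_dvdr _ prs) dvdp_map (bigD1 x) //= dvdp_mulr.
move=> /dvdp_prod_XsubC[m qm].
have : size (map_poly (in_alg L) (q x)) = 3%N by rewrite size_map_poly size_q.
rewrite (eqp_size qm) size_prod_XsubC => -[].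
case: (mask m rs) qm => // t s qm _.
have /rootP : root (map_poly (in_alg L) (q x)) t.
  by rewrite (eqp_root qm) root_prod_XsubC mem_head.
rewrite /q rmorphD rmorphB rmorph1 /= map_polyXn map_polyZ /= map_polyX !hornerE => ht.
have t0 : t != 0.
  by apply: contra_eqN ht => /eqP->; rewrite expr0n !mulr0 subr0 add0r oner_neq0.
exists t => //; apply: (mulfI t0); rewrite mulrDr mulfV // -expr2.
apply/eqP; rewrite -subr_eq0 -addrA [1 + _]addrC addrA -[X in _ == X]ht.
by rewrite [t * _]mulrC.
Qed.

Variables (F L : finFieldType) (iota : {rmorphism F -> L}).
Local Notation Q := #|F|.

Lemma pchar_nat_card : [pchar L].-nat Q.
Proof.
have [p pp pP] := finPcharP F.
have := card_pprimeChar pP; rewrite /pPrimeCharType => ->.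
by rewrite pnatX pnatE // (rmorph_pchar iota pP).
Qed.

Lemma frobenius_fixed (y : L) : y ^+ Q = y -> exists x, y = iota x.
Proof.
move=> yQ; have := congr1 (fun p => (map_poly iota p).[y]) (finField_genPoly F).
rewrite rmorphB /= map_polyXn map_polyX !hornerE yQ subrr rmorph_prod horner_prod.
move=> /esym/eqP/prodf_eq0[x _]; rewrite rmorphB /= map_polyX map_polyC !hornerE.
by rewrite subr_eq0 => /eqP; exists x.
Qed.

Lemma frobenius_base (x : F) : iota x ^+ Q = iota x.
Proof. by rewrite -rmorphXn /= expf_card. Qed.

(** Frobenius fixes [t + t^-1] exactly when it fixes or inverts [t]. *)
Lemma trace_inv_frobenius (t : L) : t != 0 ->
  ((t + t^-1) ^+ Q == t + t^-1) = (t ^+ Q.-1 == 1) || (t ^+ Q.+1 == 1).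
Proof.
move=> t0; rewrite exprDn_pchar ?pchar_nat_card // exprVn.
have Q0 : (0 < Q)%N by rewrite ltnW // finNzRing_gt1.
have tQ0 : t ^+ Q != 0 by rewrite expf_neq0.
have -> : (t ^+ Q.-1 == 1) = (t ^+ Q == t).
  by rewrite -[in RHS](prednK Q0) exprS -[X in _ = (_ == X)]mulr1 (inj_eq (mulfI t0)).
have -> : (t ^+ Q.+1 == 1) = (t * t ^+ Q == 1) by rewrite exprS.
move: (t ^+ Q) tQ0 => s s0; rewrite -subr_eq0.
rewrite -(mulrI_eq0 _ (mulfI (mulf_neq0 t0 s0))).
rewrite [_ * _](_ : _ = (s - t) * (t * s - 1)); last by field; apply/andP.
by rewrite mulf_eq0 !subr_eq0.
Qed.

Hypothesis iota_trace : forall x : F, exists2 t : L, t != 0 & t + t^-1 = iota x.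

Lemma eq_trace_inv (s t : L) : s != 0 -> t != 0 ->
  (s + s^-1 == t + t^-1) = (s == t) || (s == t^-1).
Proof.
move=> s0 t0; rewrite -subr_eq0.
rewrite -(mulrI_eq0 _ (mulfI (mulf_neq0 s0 t0))).
rewrite [_ * _](_ : _ = t * (s - t) * (s - t^-1)); last by field; apply/andP.
by rewrite !mulf_eq0 !subr_eq0 (negPf t0).
Qed.

Lemma expf1_neq0 (t : L) (n : nat) : (0 < n)%N -> t ^+ n == 1 -> t != 0.
Proof.
by move=> n0; apply: contraTneq => ->; rewrite expr0n eqn0Ngt n0 eq_sym oner_eq0.
Qed.

(** The preimages of [x] are a root [t] of [t ^+ 2 - x * t + 1] and its inverse,
    both on the same torus; when they coincide, [t] is 1 or -1 and lies on both
    tori.  Either way the count is 2. *)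
Lemma card_fiber_trace (x : F) :
  (#|[pred t : L | (t ^+ Q.-1 == 1)%R && (t + t^-1 == iota x)%R]|
   + #|[pred t : L | (t ^+ Q.+1 == 1)%R && (t + t^-1 == iota x)%R]| = 2)%N.
Proof.
have [t t0 tx] := iota_trace x.
have tV0 : t^-1 != 0 by rewrite invr_eq0.
have Q1 := card_pred_gt0 F.
have fiberE n : (0 < n)%N ->
    #|[pred s : L | (s ^+ n == 1) && (s + s^-1 == iota x)]|
      = ((t ^+ n == 1)%R * (t != t^-1)%R.+1)%N.
  move=> n0; have [tn|tn] := boolP (t ^+ n == 1).
    rewrite mul1n -card2; apply: eq_card => s; rewrite !inE -tx.
    apply/andP/idP => [[sn]|].
      by rewrite eq_trace_inv // (expf1_neq0 n0 sn).
    case/orP => /eqP->; first by rewrite tn.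
    by rewrite exprVn (eqP tn) invr1 eqxx invrK addrC.
  rewrite mul0n; apply: eq_card0 => s; rewrite !inE -tx.
  apply/negP => /andP[sn]; rewrite eq_trace_inv ?(expf1_neq0 n0 sn) //.
  case/orP => /eqP st; move: sn; rewrite st ?exprVn ?invr_eq1; exact/negP.
rewrite !fiberE //.
have : (t ^+ Q.-1 == 1) || (t ^+ Q.+1 == 1).
  by rewrite -trace_inv_frobenius // tx frobenius_base.
have tE : (t == t^-1) = (t ^+ 2 == 1).
  by rewrite -(inj_eq (mulfI t0)) mulfV // expr2.
have Q2 : t ^+ Q.+1 = t ^+ Q.-1 * t ^+ 2.
  by rewrite -exprD addn2 prednK // ltnW // finNzRing_gt1.
rewrite tE Q2; have [t2|t2] := eqVneq (t ^+ 2) 1.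
  by rewrite t2 mulr1; case: (t ^+ Q.-1 == 1).
have [->|_ /= ->] := eqVneq (t ^+ Q.-1) 1; last by [].
by rewrite mul1r (negPf t2).
Qed.

Lemma double_sum_base (f : L -> int) :
  2 * \sum_(x : F) f (iota x)
    = \sum_(t : L | t ^+ Q.-1 == 1) f (t + t^-1)
      + \sum_(t : L | t ^+ Q.+1 == 1) f (t + t^-1).
Proof.
have Q1 := card_pred_gt0 F.
have torusE n : (0 < n)%N ->
    (forall t : L, t ^+ n == 1 -> (t ^+ Q.-1 == 1) || (t ^+ Q.+1 == 1)) ->
    \sum_(t : L | t ^+ n == 1) f (t + t^-1)
      = \sum_(x : F) #|[pred t : L | (t ^+ n == 1) && (t + t^-1 == iota x)]|%:R
          * f (iota x).
  move=> n0 hn; transitivity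
    (\sum_(t : L | t ^+ n == 1) \sum_(x : F | t + t^-1 == iota x) f (iota x)).
    apply: eq_bigr => t tn; have t0 := expf1_neq0 n0 tn.
    have [x tx] : exists x, t + t^-1 = iota x.
      by apply/frobenius_fixed/eqP; rewrite trace_inv_frobenius ?hn.
    rewrite (big_pred1 x) ?tx // => y.
    by rewrite (inj_eq (fmorph_inj iota)) eq_sym.
  rewrite (exchange_big_dep predT) //=; apply: eq_bigr => x _.
  by rewrite sumr_const mulr_natl.
rewrite !torusE //; first last.
- by move=> t ->.
- by move=> t ->; rewrite orbT.
rewrite -big_split mulr_sumr; apply: eq_bigr => x _ /=.
by rewrite -mulrDl -natrD card_fiber_trace.
Qed.

(** The first torus is the multiplicative group of the base field; the order of
    the second follows from the first by summing the constant 1. *)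
Lemma card_torus :
  #|[pred t : L | t ^+ Q.-1 == 1%R]| = Q.-1 /\
  #|[pred t : L | t ^+ Q.+1 == 1%R]| = Q.+1.
Proof.
have Q1 := card_pred_gt0 F.
have h1 : #|[pred t : L | t ^+ Q.-1 == 1%R]| = Q.-1.
  apply/eqP; rewrite eqn_leq; apply/andP; split.
    rewrite cardE max_unity_roots ?enum_uniq //.
    by apply/allP => t; rewrite mem_enum inE unity_rootE.
  rewrite -[X in (X <= _)%N](cardC1 (0 : F)) -(card_image (fmorph_inj iota)).
  apply: subset_leq_card; apply/subsetP => t /imageP[x x0 ->].
  by rewrite inE -rmorphXn /= expf_pred ?rmorph1.
split => //; have := double_sum_base (fun=> 1).
rewrite !sumr_const h1 -[_ *+ Q]mulr_natl !mulr1.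
have := prednK (ltnW (finNzRing_gt1 F)).
move: #|[pred t : L | t ^+ Q.+1 == 1]| => a; lia.
Qed.

Lemma torus_prim_root (n : nat) : n = Q.-1 \/ n = Q.+1 ->
  exists z : L, n.-primitive_root z.
Proof.
have [h1 h2] := card_torus.
have Q1 := card_pred_gt0 F.
move=> nQ; have [n0 hn] : (0 < n)%N /\ #|[pred t : L | t ^+ n == 1%R]| = n.
  by case: nQ => ->.
have /hasP[z _ zP] : has n.-primitive_root (enum [pred t : L | t ^+ n == 1%R]).
  apply: has_prim_root; rewrite ?enum_uniq -?cardE ?hn //.
  by apply/allP => t; rewrite mem_enum inE unity_rootE.
by exists z.
Qed.

End ToriInExtension.

(** * A second moment over the plane *)

Section SecondMoment.
Local Open Scope ring_scope.

Variable F : finFieldType.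
Local Notation Q := #|F|.
Local Notation chi := (@qchar Q F).
Hypothesis oddF : odd Q.

Definition dot2 (z w : F * F) : F := z.1 * w.1 + z.2 * w.2.
Definition det2 (w w' : F * F) : F := w.1 * w'.2 - w'.1 * w.2.

Lemma sum_dot2 (w w' : F * F) (f : F -> F -> int) : det2 w w' != 0 ->
  \sum_z f (dot2 z w) (dot2 z w') = \sum_u \sum_v f u v.
Proof.
rewrite /dot2 /det2; case: w w' => [a b] [c d] /= D0.
pose h (z : F * F) := ((z.1 * d - z.2 * b) / (a * d - c * b),
                       (z.2 * a - z.1 * c) / (a * d - c * b)).
rewrite (reindex h) /=; last first.
  exists (fun z => (z.1 * a + z.2 * b, z.1 * c + z.2 * d)) => -[u v] _;
    by rewrite /h /=; congr pair; field.
rewrite pair_big /=; apply: eq_bigr => -[u v] _.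
by congr f; rewrite /h /=; field.
Qed.

(** Two independent linear forms are coordinates of the plane, so the double sum
    is a product of two complete character sums. *)
Lemma sum_qchar_dot2_indep (w w' : F * F) : det2 w w' != 0 ->
  \sum_z chi (dot2 z w) * chi (dot2 z w') = 0.
Proof.
move=> D0; rewrite (sum_dot2 (fun u v => chi u * chi v) D0).
by rewrite big1 // => u _; rewrite -mulr_sumr sum_qchar ?mulr0.
Qed.

Lemma sum_qchar_dot2_sq (w : F * F) : w != 0 ->
  \sum_z chi (dot2 z w) ^+ 2 = (Q * Q.-1)%:R.
Proof.
move=> w0; have [w' D0] : exists w', det2 w w' != 0.
  rewrite /det2; case: w w0 => a b; rewrite xpair_eqE negb_and.
  have [-> /= b0|a0 _] := eqVneq a 0.
    by exists (1, 0); rewrite /= mulr0 mul1r sub0r oppr_eq0.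
  by exists (0, 1); rewrite /= mulr1 mul0r subr0.
rewrite (sum_dot2 (fun u _ => chi u ^+ 2) D0).
transitivity (\sum_(u : F) Q%:R * (u != 0)%:R : int).
  by apply: eq_bigr => u _; rewrite sumr_const qchar_sq // -[LHS]mulr_natl.
rewrite -mulr_sumr -natr_sum natrM -(cardC1 (0 : F)) -[#|predC1 0|]sum1_card.
by rewrite [in RHS]big_mkcond.
Qed.

(** Squaring and exchanging the sums, only the pairs of proportional forms
    survive.  The involution [sigma] lists them: a form and its partner
    contribute equally, which is the factor 2. *)
Lemma second_moment (I : finType) (P : pred I) (sigma : I -> I)
    (w : I -> F * F) (eps : I -> int) :
  (forall i, P i -> [/\ P (sigma i), sigma i != i, w i != 0 & eps i ^+ 2 = 1]) ->
  (forall i z, P i ->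
     eps (sigma i) * chi (dot2 z (w (sigma i))) = eps i * chi (dot2 z (w i))) ->
  (forall i j, P i -> P j -> j != i -> j != sigma i -> det2 (w i) (w j) != 0) ->
  \sum_z (\sum_(i | P i) eps i * chi (dot2 z (w i))) ^+ 2
    = (2 * #|P| * (Q * Q.-1))%:R.
Proof.
move=> hP hs hD.
transitivity (\sum_(i | P i) \sum_(j | P j)
    eps i * eps j * \sum_z chi (dot2 z (w i)) * chi (dot2 z (w j))).
  under eq_bigr => z _.
    rewrite expr2 mulr_suml; under eq_bigr => i _ do rewrite mulr_sumr.
    over.
  rewrite exchange_big /=; apply: eq_bigr => i _.
  rewrite exchange_big /=; apply: eq_bigr => j _.
  by rewrite mulr_sumr; apply: eq_bigr => z _; ring.
transitivity (\sum_(i | P i) (2 * (Q * Q.-1))%:R : int); last first.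
  by rewrite sumr_const -[LHS]mulr_natl -natrM mulnCA mulnA.
apply: eq_bigr => i Pi; have [Psi si wi ei] := hP i Pi.
rewrite (bigD1 i) //= (bigD1 (sigma i)) /=; last by rewrite Psi si.
rewrite [X in _ + (_ + X)]big1 ?addr0 => [|j /andP[/andP[Pj ji] jsi]]; last first.
  by rewrite sum_qchar_dot2_indep ?mulr0 // hD.
have -> : eps i * eps i * \sum_z chi (dot2 z (w i)) * chi (dot2 z (w i))
    = (Q * Q.-1)%:R.
  by rewrite -expr2 ei mul1r -(sum_qchar_dot2_sq wi).
suff -> : eps i * eps (sigma i)
            * \sum_z chi (dot2 z (w i)) * chi (dot2 z (w (sigma i)))
    = (Q * Q.-1)%:R by rewrite -natrD addnn mul2n.
rewrite mulr_sumr -(sum_qchar_dot2_sq wi); apply: eq_bigr => z _.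
transitivity (eps i * chi (dot2 z (w i))
              * (eps (sigma i) * chi (dot2 z (w (sigma i))))); first by ring.
rewrite hs //; transitivity (eps i ^+ 2 * chi (dot2 z (w i)) ^+ 2); first by ring.
by rewrite ei mul1r.
Qed.

End SecondMoment.

(** * A square-root bound for the torus sums *)

Section TorusSumBound.
Local Open Scope ring_scope.

Variables (F L : finFieldType) (iota : {rmorphism F -> L}).
Local Notation Q := #|F|.
Local Notation chi := (@qchar Q F).
Hypothesis oddF : odd Q.

Variables (n M : nat) (g : L).
Hypothesis nQ : n = Q.-1 \/ n = Q.+1.
Hypothesis n_gt2 : (2 < n)%N.
Hypothesis gP : n.-primitive_root g.
Hypothesis M_dvd_n : (M %| n)%N.
Hypothesis M_even : ~~ odd M.
Hypothesis chiN1 : chi (-1) = 1.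

Definition on_torus (t : L) : bool := t ^+ n == 1.

Lemma torus_neq0 (t : L) : on_torus t -> t != 0.
Proof. exact: expf1_neq0 (prim_order_gt0 gP). Qed.

Lemma torusM (s t : L) : on_torus s -> on_torus t -> on_torus (s * t).
Proof. by move=> /eqP hs /eqP ht; rewrite /on_torus exprMn hs ht mulr1. Qed.

Lemma torus_gen : on_torus g.
Proof. by rewrite /on_torus prim_expr_order. Qed.

Lemma torus_unity (h : L) : h ^+ M == 1 -> on_torus h.
Proof.
move=> /eqP hM; rewrite /on_torus; case/dvdnP: M_dvd_n => k ->.
by rewrite mulnC exprM hM expr1n.
Qed.

(** The split torus consists of the points fixed by Frobenius; on the norm one
    torus Frobenius is the conjugation of the quadratic extension, which is the
    inversion. *)
Lemma torus_frobenius :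
  (forall t, on_torus t -> t ^+ Q = t) \/ (forall t, on_torus t -> t ^+ Q = t^-1).
Proof.
have Q0 : (0 < Q)%N := ltnW (finNzRing_gt1 F).
case: nQ => nE; [left|right] => t tt; have t0 := torus_neq0 tt.
  by rewrite -(prednK Q0) exprS -nE (eqP tt) mulr1.
by apply: (mulfI t0); rewrite mulfV // -exprS -nE (eqP tt).
Qed.

Lemma frobeniusD (x y : L) : (x + y) ^+ Q = x ^+ Q + y ^+ Q.
Proof. exact: exprDn_pchar (pchar_nat_card iota). Qed.

Lemma frobeniusB (x y : L) : (x - y) ^+ Q = x ^+ Q - y ^+ Q.
Proof. by rewrite frobeniusD [(- y) ^+ _]exprNn -signr_odd oddF mulN1r. Qed.

(** A preimage under [iota]; the default 0 is never reached on elements fixed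
    by Frobenius. *)
Definition to_base (y : L) : F := odflt 0 [pick x | iota x == y].

Lemma to_baseK (y : L) : y ^+ Q = y -> iota (to_base y) = y.
Proof.
move=> /(frobenius_fixed iota)[x ->]; rewrite /to_base.
by case: pickP => [x' /eqP //|/(_ x)]; rewrite eqxx.
Qed.

Definition tau (t : L) : F := to_base (t + t^-1).

Lemma tauK (t : L) : on_torus t -> iota (tau t) = t + t^-1.
Proof.
move=> tt; apply: to_baseK; rewrite frobeniusD exprVn.
by case: torus_frobenius => -> //; rewrite invrK addrC.
Qed.

Lemma tauN (t : L) : on_torus t -> tau (- t) = - tau t.
Proof.
move=> tt; apply: (fmorph_inj iota); rewrite rmorphN /= !tauK //.
  by rewrite invrN opprD.
rewrite /on_torus exprNn -signr_odd (_ : odd n = false) ?mul1r //.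
by move: M_even; case/dvdnP: M_dvd_n => k ->; rewrite oddM => /negPf->; rewrite andbF.
Qed.

Lemma sqr_gen_neq1 : g ^+ 2 - 1 != 0.
Proof. by rewrite subr_eq0 -(prim_order_dvd gP) gtnNdvd. Qed.

Lemma gen_subV_neq0 : g - g^-1 != 0.
Proof.
have g0 := torus_neq0 torus_gen; rewrite subr_eq0 -(inj_eq (mulfI g0)) mulfV //.
by rewrite -expr2 -subr_eq0 sqr_gen_neq1.
Qed.

(** The pair [(tau h, tau (g * h))] encodes the linear form
    [(a, b) |-> Tr ((a + b * g) * h)], where [Tr u] is the sum of [u] and its
    conjugate: on a point of either torus the conjugate is the inverse. *)
Definition trace_form (h : L) : F * F := (tau h, tau (g * h)).

(** The coordinates of a point [v] of the torus in the basis [1, g]. *)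
Definition coord0 (v : L) : L := (g / v - v / g) / (g - g^-1).
Definition coord1 (v : L) : L := (v - v^-1) / (g - g^-1).

Lemma coord1K (v : L) : on_torus v -> iota (to_base (coord1 v)) = coord1 v.
Proof.
move=> tv; have tg := torus_gen.
apply: to_baseK; rewrite /coord1 exprMn exprVn !frobeniusB !exprVn.
case: torus_frobenius => frob; rewrite !frob // !invrK.
by rewrite -opprB -[g^-1 - g]opprB invrN mulrNN.
Qed.

Lemma coord0K (v : L) : on_torus v -> iota (to_base (coord0 v)) = coord0 v.
Proof.
move=> tv; have tg := torus_gen.
apply: to_baseK; rewrite /coord0 exprMn exprVn !frobeniusB !exprMn !exprVn.
case: torus_frobenius => frob; rewrite !frob // !invrK -[g^-1 - g]opprB.
by rewrite invrN mulrN -mulNr opprB [g^-1 * v]mulrC [v^-1 * g]mulrC.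
Qed.

(** The factor [y] lets a scalar of the base field be carried along. *)
Lemma coordK (y v : L) : on_torus v ->
  y * v = y * coord0 v + y * coord1 v * g /\
  y / v = y * coord0 v + y * coord1 v / g.
Proof.
move=> tv; have v0 := torus_neq0 tv; have g0 := torus_neq0 torus_gen.
by rewrite /coord0 /coord1; split; field; rewrite g0 v0 -expr2 sqr_gen_neq1.
Qed.

(** The coordinates of [c * v] for a scalar [c] and a torus point [v]. *)
Definition scaled_point (cv : F * L) : F * F :=
  (cv.1 * to_base (coord0 cv.2), cv.1 * to_base (coord1 cv.2)).

Lemma dot2_scaled_point (c : F) (v h : L) : on_torus v -> on_torus h ->
  dot2 (scaled_point (c, v)) (trace_form h) = c * tau (h * v).
Proof.
move=> tv th; have tg := torus_gen.
apply: (fmorph_inj iota); rewrite /dot2 /= rmorphD !rmorphM /=.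
rewrite coord0K // coord1K // !tauK ?torusM // /coord0 /coord1.
have := (torus_neq0 tv, torus_neq0 th, torus_neq0 tg) => -[[v0 h0] g0].
by field; rewrite v0 h0 g0 -expr2 sqr_gen_neq1.
Qed.

Lemma trace_form_neq0 (h : L) : on_torus h -> trace_form h != 0.
Proof.
move=> th; have h0 := torus_neq0 th; have g0 := torus_neq0 torus_gen.
apply/eqP => -[] /(congr1 iota) + /(congr1 iota).
rewrite !tauK ?torusM ?torus_gen // !rmorph0 => e1 e2.
have : g * h * (h + h^-1) - h * (g * h + (g * h)^-1) = g - g^-1.
  by field; rewrite g0 h0.
by rewrite e1 e2 !mulr0 subrr => /esym/eqP; rewrite (negPf gen_subV_neq0).
Qed.

Lemma det2_trace_form (h k : L) : on_torus h -> on_torus k ->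
  k != h -> k != - h -> det2 (trace_form h) (trace_form k) != 0.
Proof.
move=> th tk kh kNh; have tg := torus_gen.
have [h0 k0] := (torus_neq0 th, torus_neq0 tk); have g0 := torus_neq0 tg.
rewrite -(fmorph_eq0 iota) /det2 rmorphB !rmorphM /= !tauK ?torusM //.
rewrite [X in X != 0](_ : _ = (g - g^-1) * ((k - h) * (k + h)) / (h * k)).
  rewrite !mulf_neq0 ?invr_eq0 ?mulf_neq0 // ?gen_subV_neq0 ?subr_eq0 //.
  by rewrite addr_eq0.
by field; rewrite ?g0 ?h0 ?k0.
Qed.

Local Notation mu := [pred h : L | h ^+ M == 1].

Definition trace_sum (z : F * F) : int :=
  \sum_(h : L | h ^+ M == 1) 1 * chi (dot2 z (trace_form h)).

Lemma trace_sum_moment : \sum_z trace_sum z ^+ 2 = (2 * #|mu| * (Q * Q.-1))%:R.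
Proof.
have L2 : (2 : L) != 0 by rewrite -(rmorph_nat iota) fmorph_eq0 natf2_neq0.
apply: (second_moment oddF (sigma := -%R)) => [h Vh|h z Vh|h k Vh Vk].
- have th := torus_unity Vh; have h0 := torus_neq0 th.
  split; rewrite ?expr1n ?trace_form_neq0 //.
    by rewrite exprNn -signr_odd (negPf M_even) mul1r.
  by rewrite eq_sym -addr_eq0 -mulr2n -mulr_natl mulf_neq0.
- rewrite !mul1r; have th := torus_unity Vh.
  have -> : dot2 z (trace_form (- h)) = (-1) * dot2 z (trace_form h).
    rewrite /dot2 /trace_form /= mulrN !tauN ?torusM ?torus_gen //.
    by rewrite !mulrN mulN1r opprD.
  by rewrite qcharM // chiN1 mul1r.
exact: det2_trace_form (torus_unity Vh) (torus_unity Vk).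
Qed.

(** The trace sum is the same, up to sign, at all the points [c * v]: replacing
    [h] by [h * v] permutes the roots of unity. *)
Lemma trace_sum_scaled_point (c : F) (v : L) : c != 0 -> v ^+ M == 1 ->
  trace_sum (scaled_point (c, v)) ^+ 2 = torus_sum Q L M ^+ 2.
Proof.
move=> c0 Vv; have tv := torus_unity Vv; have v0 := torus_neq0 tv.
suff -> : trace_sum (scaled_point (c, v)) = chi c * torus_sum Q L M.
  by rewrite exprMn qchar_sq // c0 mul1r.
rewrite /torus_sum (reindex (fun h => h * v)) /=; last first.
  by exists (fun h => h / v) => h _; rewrite ?mulfK ?mulfVK.
rewrite mulr_sumr /trace_sum; apply: eq_big => [h|h Vh].
  by rewrite exprMn (eqP Vv) mulr1.
have th := torus_unity Vh; rewrite mul1r dot2_scaled_point // qcharM //.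
by rewrite -(qchar_map _ iota (tau _)) tauK // torusM.
Qed.

Lemma scaled_point_fiber (z : F * F) :
  (#|[pred cv : F * L | (cv.1 != 0)%R && (cv.2 ^+ M == 1)%R
                        && (scaled_point cv == z)]| <= 2)%N.
Proof.
case: (pickP [pred cv : F * L | (cv.1 != 0)%R && (cv.2 ^+ M == 1)%R
                        && (scaled_point cv == z)]); last first.
  by move=> /eq_card0->.
move=> [c v] /= /andP[/andP[c0 Vv] /eqP zE]; have tv := torus_unity Vv.
apply: (leq_trans (n := #|pred2 (c, v) (- c, - v)|)); last first.
  by rewrite card2; case: (_ != _).
apply: subset_leq_card; apply/subsetP => -[c' v'] /=; rewrite !inE /=.
move=> /andP[/andP[c0' Vv'] /eqP zE']; have tv' := torus_unity Vv'.
have [e1 e2] : iota c' * v' = iota c * v /\ iota c' / v' = iota c / v.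
  move: zE'; rewrite -zE => -[] /(congr1 iota) + /(congr1 iota).
  rewrite !rmorphM /= !coord0K // !coord1K // => ea eb.
  have [l1 l2] := coordK (iota c') tv'; have [l3 l4] := coordK (iota c) tv.
  by rewrite l1 l2 l3 l4 ea eb.
have : c' ^+ 2 == c ^+ 2.
  rewrite -(inj_eq (fmorph_inj iota)) !rmorphXn /= !expr2.
  have sq (x y : L) : y != 0 -> x * x = x * y * (x / y) by move=> y0; field.
  by rewrite (sq _ _ (torus_neq0 tv')) e1 e2 -sq // (torus_neq0 tv).
rewrite eqf_sqr => /orP[] /eqP cc; rewrite cc in e1 *.
  by have /mulfI-> := e1; rewrite ?fmorph_eq0 ?eqxx.
have -> : v' = - v.
  apply: (@mulfI _ (iota (- c))); rewrite ?fmorph_eq0 ?oppr_eq0 //.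
  by rewrite e1 rmorphN mulrNN.
by rewrite eqxx orbT.
Qed.

Lemma card_unity_dvd : #|mu| = M.
Proof.
have h : (n %/ gcdn (n %/ M) n = M)%N.
  rewrite (gcdn_idPl _); last by rewrite -{2}(divnK M_dvd_n) dvdn_mulr.
  case/dvdnP: M_dvd_n (prim_order_gt0 gP) => k ->.
  by rewrite muln_gt0 => /andP[k0 M0]; rewrite mulnK // mulKn.
have wP := exp_prim_root gP (n %/ M); rewrite h in wP.
have := sum_unity_prim (fun=> 1) wP.
by rewrite !sumr_const card_ord => /eqP; rewrite (eqr_nat int) => /eqP.
Qed.

(** The [(Q - 1) * M] pairs [(c, v)] cover every point of the plane at most
    twice, and at each of them the square of the trace sum is the square of
    the torus sum; the second moment [2 * M * Q * (Q - 1)] therefore bounds the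
    latter by [4 * Q].  Only the whole plane has a computable moment: over the
    torus alone, products of two characters would not decouple. *)
Lemma torus_sum_bound : torus_sum Q L M ^+ 2 <= (4 * Q)%:R.
Proof.
have M0 : (0 < M)%N by rewrite (dvdn_gt0 (prim_order_gt0 gP) M_dvd_n).
have bound : (Q.-1 * M)%:R * torus_sum Q L M ^+ 2 <= 2 * \sum_z trace_sum z ^+ 2.
  apply: (le_trans (y := \sum_(cv : F * L | (cv.1 != 0) && (cv.2 ^+ M == 1))
                           trace_sum (scaled_point cv) ^+ 2)).
    rewrite -(pair_big (fun c => c != 0) mu
      (fun c v => trace_sum (scaled_point (c, v)) ^+ 2)) /=.
    rewrite (eq_bigr (fun=> \sum_(v | mu v) torus_sum Q L M ^+ 2)) => [|c c0].
      rewrite !sumr_const card_unity_dvd (cardC1 (0 : F)) -mulrnA mulr_natl.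
      by rewrite mulnC.
    by apply: eq_bigr => v Vv; rewrite trace_sum_scaled_point.
  rewrite (partition_big scaled_point predT) //= mulr_sumr.
  apply: ler_sum => z _.
  rewrite (eq_bigr (fun=> trace_sum z ^+ 2)) => [|cv /andP[_ /eqP->] //].
  rewrite sumr_const -[_ *+ _]mulr_natl ler_wpM2r ?sqr_ge0 //.
  by rewrite (ler_nat _ _ 2) scaled_point_fiber.
have QM0 : 0 < ((Q.-1 * M)%:R : int) by rewrite ltr0n muln_gt0 card_pred_gt0.
rewrite -(ler_pM2l QM0); apply: (le_trans bound).
rewrite trace_sum_moment card_unity_dvd -!natrM ler_nat.
by move: Q.-1 => r; lia.
Qed.

End TorusSumBound.

(** * Maximality as a congruence *)

Lemma odd_sqr_mod8 (q : nat) : odd q -> exists k, q ^ 2 = 8 * k + 1.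
Proof.
move=> oddq.
have [j ->] : exists j, q = j.*2.+1.
  by exists q./2; rewrite -[LHS]odd_double_half oddq.
have [i ij] : exists i, j * j.+1 = i.*2.
  by exists (j * j.+1)./2; rewrite -[LHS]odd_double_half oddM /= andbN.
by exists i; lia.
Qed.

Section MaximalCongruence.
Local Open Scope ring_scope.

(** Minus the trace of Frobenius on the elliptic curve [y ^ 2 = x ^ 3 + x],
    which has complex multiplication by [Z[i]]. *)
Definition cm_sum (F : finFieldType) : int :=
  \sum_(t : F) qchar #|F| (t ^+ 3 + t).

(** On the split torus the character of [x + x^-1] is that of [x ^ 3 + x], since
    the two differ by a square. *)
Lemma torus_sum_split (F L : finFieldType) (iota : {rmorphism F -> L}) :
  odd #|F| -> torus_sum #|F| L #|F|.-1 = cm_sum F.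
Proof.
move=> oddF; rewrite /torus_sum /cm_sum.
have Q1 := card_pred_gt0 F.
transitivity (\sum_(y : L | y ^+ #|F|.-1 == 1) \sum_(x | iota x == y)
    qchar #|F| (iota x + (iota x)^-1)).
  apply: eq_bigr => y yQ.
  have [x yx] : exists x, y = iota x.
    apply: frobenius_fixed; rewrite -(prednK (ltnW (finNzRing_gt1 F))) exprS.
    by rewrite (eqP yQ) mulr1.
  rewrite (big_pred1 x) ?yx // => x'.
  by rewrite (inj_eq (fmorph_inj iota)).
rewrite (exchange_big_dep predT) //= (bigD1 (0 : F)) //= [RHS](bigD1 (0 : F)) //=.
congr (_ + _).
  rewrite expr0n add0r qchar0 rmorph0 big1 // => y /andP[/(expf1_neq0 Q1) y0].
  by rewrite eq_sym (negPf y0).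
apply: eq_bigr => x x0; rewrite (big_pred1 (iota x)) => [|y]; last first.
  rewrite /= [in RHS]eq_sym; apply: andb_idl => /eqP <-.
  by rewrite -rmorphXn /= expf_pred ?rmorph1.
rewrite -fmorphV -rmorphD /= qchar_map.
have -> : x ^+ 3 + x = x ^+ 2 * (x + x^-1) by field.
by rewrite qcharM // qcharX2 // mul1r.
Qed.

(** With [e1] and [e2] the greatest common divisors of [d] with [q ^ 2 - 1] and
    [q ^ 2 + 1], twice the character sum of the curve is [e1 * U1 + e2 * U2],
    where [U1, U2 <= 2 * q].  If the sum has its maximal value, then
    [d <= e1 + e2 + 1]; as [e1] and [e2] are coprime odd divisors of [d], one of
    them is [d] and the other is 1, or both are 1.  In the last case the sum
    would vanish, since [U1 + U2] is then twice the sum for [d = 1].  Modulo [d]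
    only the term with coefficient 1 is left, and it is [cm_sum F] up to sign
    because the two full torus sums are opposite, again by the case [d = 1]. *)
Lemma maximal_congruence (F : finFieldType) (d q : nat) :
  odd d -> (1 < d)%N -> odd q -> maximal_over F d q ->
  (d %| (q ^ 2).-1)%N /\ (d%:Z %| cm_sum F - (2 * q)%:Z)%Z \/
  (d %| (q ^ 2).+1)%N /\ (d%:Z %| cm_sum F + (2 * q)%:Z)%Z.
Proof.
move=> oddd d1 oddq hmax.
have cardF : #|F| = (q ^ 2)%N by case: hmax.
have oddF : odd #|F| by rewrite cardF oddX oddq.
have [_] := maximal_over_sum oddd oddF hmax; set S := \sum_x _ => hS.
have q1 : (1 < q)%N.
  by have := finNzRing_gt1 F; rewrite cardF; case: q {hmax oddq cardF hS} => [|[]].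
have [L [iota hL]] := reciprocal_ext F.
have dsum e : (2 * \sum_(x : F) qchar #|F| (chebyshev_poly F e).[x] =
   \sum_(t : L | t ^+ #|F|.-1 == 1) qchar #|F| (t ^+ e + (t ^+ e)^-1)
   + \sum_(t : L | t ^+ #|F|.+1 == 1) qchar #|F| (t ^+ e + (t ^+ e)^-1))%R.
  have Q1 := card_pred_gt0 F.
  have hf x : qchar #|F| (chebyshev_poly F e).[x]
      = qchar #|F| (chebyshev_poly L e).[iota x].
    by rewrite -(map_chebyshev_poly iota) horner_map qchar_map.
  rewrite (eq_bigr _ (fun x _ => hf x)).
  rewrite (double_sum_base hL (fun y => qchar #|F| (chebyshev_poly L e).[y])).
  by congr (_ + _); apply: eq_bigr => t tn;
    rewrite horner_chebyshev_poly // (expf1_neq0 _ tn).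
have [g1 g1P] : exists z : L, #|F|.-1.-primitive_root z.
  by apply: (torus_prim_root hL); left.
have [g2 g2P] : exists z : L, #|F|.+1.-primitive_root z.
  by apply: (torus_prim_root hL); right.
have dsumU e : 2 * \sum_(x : F) qchar #|F| (chebyshev_poly F e).[x] =
     (gcdn e #|F|.-1)%:R * torus_sum #|F| L (#|F|.-1 %/ gcdn e #|F|.-1)
   + (gcdn e #|F|.+1)%:R * torus_sum #|F| L (#|F|.+1 %/ gcdn e #|F|.+1).
  rewrite dsum /torus_sum.
  by rewrite -(sum_unity_expr e _ g1P) -(sum_unity_expr e _ g2P).
(* The case [d = 1]: [phi_1 x = x], and the values of [chi] sum to 0. *)
have U0 : torus_sum #|F| L #|F|.-1 + torus_sum #|F| L #|F|.+1 = 0.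
  have := dsumU 1; rewrite !gcd1n !divn1 !mul1r => <-.
  rewrite /chebyshev_poly Chebyshev1 map_polyX.
  by under eq_bigr => x _ do rewrite hornerX; rewrite sum_qchar // mulr0.
have := dsumU d; rewrite -/S hS.
(* Both tori have even order greater than 2, and -1 is a square in [F]. *)
have [k kQ] := odd_sqr_mod8 oddq.
have k0 : (0 < k)%N.
  case: k kQ q1 => //; rewrite muln0.
  by case: q {oddq hmax hS cardF} => [|[|j]].
have Q1N : (#|F|.-1 = 8 * k)%N by rewrite cardF kQ; lia.
have Q2N : (#|F|.+1 = 8 * k + 2)%N by rewrite cardF kQ; lia.
have chiN1 : qchar #|F| (-1 : F) = 1.
  rewrite /qchar oppr_eq0 oner_eq0 Q1N (_ : (8 * k)./2 = 2 * (2 * k))%N; last by lia.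
  by rewrite exprM sqrrN expr1n expr1n eqxx.
set e1 := gcdn d _; set e2 := gcdn d _.
have bound n e : n = #|F|.-1 \/ n = #|F|.+1 -> e = gcdn d n ->
    torus_sum #|F| L (n %/ e) <= (2 * q)%:R.
  move=> hn he; have [g gP] : exists z : L, n.-primitive_root z.
    exact: (torus_prim_root hL).
  have en : (e %| n)%N by rewrite he dvdn_gcdr.
  have odde : odd e by rewrite (dvdn_odd _ oddd) // he dvdn_gcdl.
  have evn : ~~ odd n by case: hn => ->; rewrite ?Q1N ?Q2N; lia.
  have : torus_sum #|F| L (n %/ e) ^+ 2 <= (4 * #|F|)%:R.
    apply: (torus_sum_bound iota oddF hn _ gP (dvdn_div en) _ chiN1).
      by case: hn => ->; rewrite ?Q1N ?Q2N; lia.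
    by apply: contra evn => odne; rewrite -(divnK en) oddM odne.
  rewrite cardF (_ : (4 * q ^ 2)%:R = (2 * q)%:R ^+ 2 :> int); last by lia.
  move: (torus_sum _ _ _) => u uq; have [u0|u0] := lerP u 0.
    by rewrite (le_trans u0) ?ler0n.
  by rewrite -ler_sqr // ?nnegrE ?ler0n // ltW.
have b1 := bound _ e1 (or_introl erefl) erefl.
have b2 := bound _ e2 (or_intror erefl) erefl.
have e1d : (e1 %| d)%N by rewrite dvdn_gcdl.
have e2d : (e2 %| d)%N by rewrite dvdn_gcdl.
have e1Q : (e1 %| (q ^ 2).-1)%N by rewrite -cardF dvdn_gcdr.
have e2Q : (e2 %| (q ^ 2).+1)%N by rewrite -cardF dvdn_gcdr.
have odde1 := dvdn_odd e1d oddd; have odde2 := dvdn_odd e2d oddd.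
have e12 : coprime e1 e2.
  have h : (gcdn e1 e2 %| 2)%N.
    rewrite -(dvdn_addr 2 (m := #|F|.-1)); last first.
      by rewrite (dvdn_trans (dvdn_gcdl _ _)) ?dvdn_gcdr.
    rewrite Q1N -Q2N (dvdn_trans (dvdn_gcdr _ _)) ?dvdn_gcdr //.
  rewrite /coprime; have := dvdn_leq (isT : 0 < 2)%N h.
  have : odd (gcdn e1 e2) by rewrite (dvdn_odd (dvdn_gcdl _ _)).
  by case: (gcdn e1 e2) => [|[|[|j]]].
have e12d : (e1 * e2 %| d)%N by rewrite Gauss_dvd // e1d e2d.
move=> hU; have d12 : (d <= e1 + e2 + 1)%N.
  have q0 : (0 < 2 * q)%N by rewrite muln_gt0 /= ltnW.
  suff : ((d.-1 * (2 * q))%:R : int) <= ((e1 + e2) * (2 * q))%:R.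
    by rewrite ler_nat leq_pmul2r // => h; rewrite -(prednK (ltnW d1)) addn1 ltnS.
  have -> : ((d.-1 * (2 * q))%:R : int) = 2 * (d.-1 * q)%:R by rewrite mulnCA natrM.
  rewrite hU mulnDl natrD !natrM.
  by rewrite lerD // ler_wpM2l ?ler0n // -natrM.
have arith (a u : int) : 2 * (d.-1 * q)%:R = d%:R * u + a ->
    a + (2 * q)%:Z = ((2 * q)%:Z - u) * d%:Z.
  have -> : d = d.-1.+1 by rewrite prednK // ltnW.
  by clear; move: (d.-1) => b /=; lia.
have [e1E|e1N] := eqVneq e1 1%N; have [e2E|e2N] := eqVneq e2 1%N.
- exfalso; move: hU; rewrite e1E e2E !divn1 !mul1r U0 => h.
  have h0 : (0 < d.-1 * q)%N.
    by rewrite muln_gt0 (ltnW q1) andbT; case: (d) d1 => [|[]].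
  by clear -h h0; lia.
- right; have e2d' : e2 = d.
    have e3 : (3 <= e2)%N by case: (e2) odde2 e2N => [|[|[|]]].
    case/dvdnP: e2d => j dj; have := oddd; rewrite dj oddM => /andP[oddj _].
    case: j dj oddj => [|[|[|j]]] // dj _; first by rewrite mul1n.
    have h : (3 * e2 <= d)%N by rewrite dj leq_mul.
    by move: d12; rewrite e1E; clear -h e3; lia.
  rewrite -{1}e2d' e2Q; split => //; move: hU; rewrite e1E e2d' divn1 mul1r.
  rewrite (torus_sum_split iota) // => hU; apply/dvdzP.
  exists ((2 * q)%:Z - torus_sum #|F| L (#|F|.+1 %/ d)).
  by apply: arith; rewrite hU addrC.
- left; have e1d' : e1 = d.
    have e3 : (3 <= e1)%N by case: (e1) odde1 e1N => [|[|[|]]].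
    case/dvdnP: e1d => j dj; have := oddd; rewrite dj oddM => /andP[oddj _].
    case: j dj oddj => [|[|[|j]]] // dj _; first by rewrite mul1n.
    have h : (3 * e1 <= d)%N by rewrite dj leq_mul.
    by move: d12; rewrite e2E; clear -h e3; lia.
  rewrite -{1}e1d' e1Q; split => //; move: hU; rewrite e2E e1d' divn1 mul1r.
  rewrite (_ : torus_sum _ _ #|F|.+1 = - cm_sum F); last first.
    by rewrite -(torus_sum_split iota) //; apply/eqP; rewrite -addr_eq0 addrC U0.
  move=> hU; apply/dvdzP.
  exists (torus_sum #|F| L (#|F|.-1 %/ d) - (2 * q)%:Z).
  by have := arith _ _ hU; clear; lia.
- case/dvdnP: e12d => j dj; exfalso.
  have e13 : (3 <= e1)%N by case: (e1) odde1 e1N => [|[|[|]]].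
  have e23 : (3 <= e2)%N by case: (e2) odde2 e2N => [|[|[|]]].
  have j0 : (0 < j)%N by case: j dj oddd => // ->.
  have : (e1 * e2 <= e1 + e2 + 1)%N by apply: leq_trans d12; rewrite dj leq_pmull.
  by rewrite -(subnK e13) -(subnK e23); clear; lia.
Qed.
End MaximalCongruence.

(** * Jacobsthal's identity *)

Section Jacobsthal.
Local Open Scope ring_scope.

Variable F : finFieldType.
Local Notation chi := (@qchar #|F| F).
Hypothesis oddF : odd #|F|.

(** The partner [b] of [cm_sum F] is the analogous sum for [x ^ 3 + g * x] with
    [g] a nonsquare.  The sums [J g] attached to [x ^ 3 + g * x] have a square
    that depends only on the class of [g] modulo squares, so that the second
    moment of [G (a, b) = chi a * J (b / a)] over the plane is a multiple of
    [J 1 ^+ 2 + J g ^+ 2]. *)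
Lemma jacobsthal : chi (-1) = 1 ->
  exists b : int, cm_sum F ^+ 2 + b ^+ 2 = (4 * #|F|)%:R.
Proof.
move=> chiN1.
pose J (g : F) := \sum_(t : F | t != 0) chi t * chi (t ^+ 2 + g).
have J1 : J 1 = cm_sum F.
  rewrite /cm_sum (bigD1 (0 : F)) //= expr0n add0r qchar0 add0r.
  by apply: eq_bigr => t _; rewrite -qcharM // mulrDr mulr1 -exprS.
have sum0 : \sum_(t : F | t != 0) chi t = 0.
  by have := sum_qchar oddF; rewrite (bigD1 (0 : F)) //= qchar0 add0r.
have J_sq c g : c != 0 -> J (c ^+ 2 * g) ^+ 2 = J g ^+ 2.
  move=> c0; suff -> : J (c ^+ 2 * g) = chi c * J g.
    by rewrite exprMn qchar_sq // c0 mul1r.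
  rewrite /J (reindex (fun t => c * t)) /=; last first.
    by exists (fun t => c^-1 * t) => t _; rewrite ?mulKf ?mulVKf.
  rewrite mulr_sumr; apply: eq_big => [t|t _]; first by rewrite mulf_eq0 (negPf c0).
  rewrite exprMn -mulrDr qcharM // [chi (c ^+ 2 * _)]qcharM // qcharX2 //.
  by rewrite mul1r mulrA.
have [g gN] := qchar_nonsquare oddF.
have g0 : g != 0 by rewrite -(qchar_eq0) gN.
exists (J g); rewrite -J1.
pose w (t : F) := (t ^+ 2, 1 : F).
pose G z := \sum_(t : F | t != 0) chi t * chi (dot2 z (w t)).
have moment : \sum_z G z ^+ 2
    = (2 * #|[pred t : F | t != 0]| * (#|F| * #|F|.-1))%:R.
  apply: (second_moment oddF (sigma := -%R)) => [t t0|t z t0|s t s0 t0 st sNt].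
  - rewrite oppr_eq0 t0 qchar_sq // t0 xpair_eqE oner_eq0 andbF; split => //.
    by rewrite eq_sym -addr_eq0 -mulr2n -mulr_natl mulf_neq0 ?natf2_neq0.
  - by rewrite /w sqrrN -[- t]mulN1r qcharM // chiN1 mul1r.
  rewrite /det2 /w /= !mulr1 subr_eq0 eqf_sqr negb_or eq_sym st /=.
  by rewrite -eqr_oppLR eq_sym.
have G_axis z : (z.1 == 0) || (z.2 == 0) -> G z = 0.
  rewrite /G /dot2 /w /=; case: z => a b /= /orP[] /eqP->.
    under eq_bigr => t _ do rewrite mul0r add0r mulr1.
    by rewrite -mulr_suml sum0 mul0r.
  rewrite (eq_bigr (fun t => chi t * chi a)) => [|t t0].
    by rewrite -mulr_suml sum0 mul0r.
  by rewrite mul0r addr0 [chi (_ * _)]qcharM // qcharX2 // mulr1.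
have GJ a b : a != 0 -> G (a, b) ^+ 2 = J (b / a) ^+ 2.
  move=> a0; suff -> : G (a, b) = chi a * J (b / a).
    by rewrite exprMn qchar_sq // a0 mul1r.
  rewrite /G /J mulr_sumr; apply: eq_bigr => t _; rewrite mulrCA; congr (_ * _).
  rewrite -qcharM //; congr chi; rewrite /dot2 /w /=.
  by field.
have G2 a b : a != 0 -> b != 0 ->
    2 * G (a, b) ^+ 2
      = J 1 ^+ 2 + J g ^+ 2 + chi a * chi b * (J 1 ^+ 2 - J g ^+ 2).
  move=> a0 b0; rewrite GJ //.
  have -> : chi a * chi b = chi (b / a) by rewrite qcharM // qcharV // mulrC.
  have c0 : b / a != 0 by rewrite mulf_neq0 ?invr_eq0.
  move: (b / a) c0 => c c0; have [c1|] := eqVneq (chi c) 1.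
    have [s sc] : exists s, s ^+ 2 = c by apply/(qchar_sqrtP oddF c0)/eqP.
    have s0 : s != 0 by apply: contraNneq c0 => s0; rewrite -sc s0 expr0n.
    by rewrite c1 -sc -[s ^+ 2]mulr1 J_sq //; ring.
  have cg0 : c / g != 0 by rewrite mulf_neq0 ?invr_eq0.
  case: (qchar_cases c) (qchar_eq0 c) => ce; rewrite ?ce ?(negPf c0) // => _ _.
  have [s sc] : exists s, s ^+ 2 = c / g.
    by apply/(qchar_sqrtP oddF cg0); rewrite qcharM // qcharV // gN ce.
  have s0 : s != 0 by apply: contraNneq cg0 => s0; rewrite -sc s0 expr0n.
  by rewrite (_ : c = s ^+ 2 * g) ?J_sq //; [ring | rewrite sc mulfVK].
have : 2 * \sum_z G z ^+ 2 = (#|F|.-1 * #|F|.-1)%:R * (J 1 ^+ 2 + J g ^+ 2).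
  rewrite -(pair_big predT predT (fun a b => G (a, b) ^+ 2)) /= mulr_sumr.
  rewrite (bigD1 (0 : F)) //= [X in 2 * X]big1 ?mulr0 ?add0r => [|b _]; last first.
    by rewrite G_axis ?eqxx ?expr0n.
  transitivity (\sum_(a : F | a != 0) \sum_(b : F | b != 0)
      (J 1 ^+ 2 + J g ^+ 2 + chi a * chi b * (J 1 ^+ 2 - J g ^+ 2))).
    apply: eq_bigr => a a0; rewrite (bigD1 (0 : F)) //= G_axis ?eqxx ?orbT //.
    by rewrite expr0n add0r mulr_sumr; apply: eq_bigr => b b0; rewrite G2.
  transitivity (\sum_(a : F | a != 0) #|F|.-1%:R * (J 1 ^+ 2 + J g ^+ 2)).
    apply: eq_bigr => a a0; rewrite big_split /= sumr_const (cardC1 (0 : F)).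
    by rewrite -mulr_suml -mulr_sumr sum0 mulr0 mul0r addr0 -[LHS]mulr_natl.
  by rewrite sumr_const (cardC1 (0 : F)) -[LHS]mulr_natl natrM mulrA.
rewrite moment (cardC1 (0 : F)).
have Q1 : (0 < #|F|.-1)%N by rewrite -subn1 subn_gt0 finNzRing_gt1.
move: (_ + _) => s h; apply: (mulfI (x := (#|F|.-1 * #|F|.-1)%:R)).
  by rewrite pnatr_eq0 muln_eq0 orbb -lt0n Q1.
by rewrite -h -!natrM; congr (_%:R); move: #|F|.-1 => n; lia.
Qed.

End Jacobsthal.

(** * The sum of the CM curve modulo 8 *)

Section CmSumMod8.
Local Open Scope ring_scope.

Lemma sum_odd_parity (f : nat -> int) (m n : nat) :
  (forall i, (m <= i < n)%N -> f i = 1 \/ f i = -1) ->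
  exists k : int, \sum_(m <= i < n) f i = 2 * k + (n - m)%N%:Z.
Proof.
elim: n => [|n IHn] hf; first by exists 0; rewrite big_geq.
have [mn|nm] := leqP m n; last by exists 0; rewrite big_geq //; lia.
have [k hk] := IHn (fun i hi => hf i ltac:(lia)).
rewrite big_nat_recr //= hk; have := hf n ltac:(lia).
by case=> ->; [exists k | exists (k - 1)]; lia.
Qed.

Variables (F : finFieldType) (p m : nat).
Hypotheses (pr_p : prime p) (odd_p : odd p) (m0 : (0 < m)%N).
Hypothesis cardF : #|F| = ((p ^ m) ^ 2)%N.
Local Notation chi := (@qchar #|F| F).

Lemma oddF_sq : odd #|F|. Proof. by rewrite cardF !oddX odd_p orbT. Qed.

Lemma card_mod8 : exists2 k, (0 < k)%N & (#|F|.-1 = 8 * k)%N.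
Proof.
have q1 : (1 < p ^ m)%N by rewrite -{1}(expn0 p) ltn_exp2l // prime_gt1.
have := oddF_sq; rewrite cardF oddX /=; move: (p ^ m)%N q1 => q q1 oddq.
have [k kQ] := odd_sqr_mod8 oddq; exists k; last by rewrite kQ addn1.
by case: k kQ q1 => //; rewrite muln0; case: q {oddq} => [|[|j]].
Qed.

Lemma qchar_sqfieldN1 : chi (-1) = 1.
Proof.
have [k _ kF] := card_mod8.
rewrite /qchar oppr_eq0 oner_eq0 kF (_ : (8 * k)./2 = 2 * (2 * k))%N; last by lia.
by rewrite exprM sqrrN expr1n expr1n eqxx.
Qed.

(** 2 lies in the subfield with [p ^ m] elements, all of which are
    squares in [F]. *)
Lemma qchar_sqfield2 : chi 2 = 1.
Proof.
have n20 : (2 : F) != 0 by rewrite natf2_neq0 // oddF_sq.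
have q0 : (0 < p ^ m)%N by rewrite expn_gt0 prime_gt0.
have frob2 : (2 : F) ^+ (p ^ m) = 2.
  have pF : p \in [pchar F].
    by apply: (@card_finPcharP F p (m * 2)) => //; rewrite cardF expnM.
  rewrite -[2]/(1 + 1 : F) exprDn_pchar ?expr1n //.
  by rewrite pnatX pnatE // pF.
have h2 : (2 : F) ^+ (p ^ m).-1 = 1.
  by apply: (mulfI n20); rewrite -exprS prednK // frob2 mulr1.
rewrite /qchar (negPf n20) cardF.
have -> : (((p ^ m) ^ 2).-1./2 = (p ^ m).-1 * ((p ^ m).+1)./2)%N.
  have := oddF_sq; rewrite cardF oddX /=; move: (p ^ m)%N q0 => q q0 oddq.
  have [j ->] : exists j, q = j.*2.+1 by exists q./2; rewrite -[LHS]odd_double_half oddq.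
  rewrite [X in (_ * X)%N](_ : _ = j.+1); last by lia.
  by rewrite (_ : (j.*2.+1 ^ 2).-1 = (j.*2 * j.+1).*2)%N ?doubleK //=; lia.
by rewrite exprM h2 expr1n eqxx.
Qed.

(** The summand [chi (t + t^-1)] is invariant under [t |-> - t] and
    [t |-> t^-1]: the orbits have four elements, except the one of 1, which
    contributes [2 * chi 2 = 2], and the one of a square root of -1, which
    contributes 0.  The number of the other orbits is odd because 8 divides the
    order of the group, and each contributes 4 or -4. *)
Lemma cm_sum_mod8 : exists k : int, cm_sum F = 8 * k + 6.
Proof.
have oddF := oddF_sq; have [k k0 kF] := card_mod8.
have [z zP] := finField_prim_root F.
have z0 : z != 0 by rewrite (prim_root_eq0 zP) kF; lia.
rewrite -(torus_sum_split idfun oddF) /torus_sum (sum_unity_prim _ zP).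
pose f i := chi (z ^+ i + (z ^+ i)^-1).
pose N := (2 * k)%N.
have zN : z ^+ (N + N) = -1.
  have : (z ^+ (N + N)) ^+ 2 == 1.
    by rewrite -exprM -(prim_order_dvd zP) kF /N; apply/dvdnP; exists 1%N; lia.
  rewrite sqrf_eq1 => /orP[|/eqP //].
  by rewrite -(prim_order_dvd zP) kF gtnNdvd // /N; lia.
have chiN (x : F) : chi (- x) = chi x.
  by rewrite -mulN1r qcharM // qchar_sqfieldN1 mul1r.
have f_per i : f (N + N + i)%N = f i.
  by rewrite /f exprD zN mulN1r invrN -opprD chiN.
have f_sym i : (i <= N + N)%N -> f (N + N - i)%N = f i.
  move=> iN; have -> : f i = f (N + N - i)%N.
    rewrite /f; have := exprD z i (N + N - i); rewrite subnKC // zN.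
    set a := z ^+ i; set b := z ^+ _ => ab.
    have a0 : a != 0 by rewrite expf_neq0.
    have -> : b = - a^-1 by apply: (mulfI a0); rewrite -ab mulrN mulfV.
    by rewrite invrN invrK -opprD chiN addrC.
  by [].
have f0 : f 0%N = 1 by rewrite /f expr0 invr1 -[1 + 1]/(2 : F) qchar_sqfield2.
(* [z ^+ N] is a square root of -1: its inverse is its opposite. *)
have fN : f N = 0.
  rewrite /f; have := exprD z N N; rewrite zN; set a := z ^+ N => ab.
  have a0 : a != 0 by rewrite expf_neq0.
  have -> : a^-1 = - a by apply: (mulfI a0); rewrite mulfV // mulrN -ab opprK.
  by rewrite subrr qchar0.
have f_unit i : (1 <= i < N)%N -> f i = 1 \/ f i = -1.
  move=> iN; rewrite /f; set a := z ^+ i.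
  have a0 : a != 0 by rewrite expf_neq0.
  suff : chi (a + a^-1) != 0 by case: (qchar_cases (a + a^-1)) => -> // _; [left|right].
  rewrite qchar_eq0 -(inj_eq (mulfI a0)) mulr0 mulrDr mulfV // addr_eq0 -zN -expr2 /a.
  by rewrite -exprM (eq_prim_root_expr zP) kF !modn_small /N; lia.
have [j hj] := sum_odd_parity f_unit.
have -> : \sum_(i < #|F|.-1) f i = 2 * \sum_(0 <= i < N + N) f i.
  rewrite kF (_ : 8 * k = 2 * (N + N))%N; last by rewrite /N; lia.
  by rewrite (sum_ord_periodic _ f_per) big_mkord.
have N1 : (1 <= N)%N by rewrite /N; lia.
have -> : \sum_(0 <= i < N + N) f i = 1 + 2 * \sum_(1 <= i < N) f i.
  rewrite [LHS]big_ltn; last by rewrite addn_gt0 N1.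
  rewrite f0; congr (_ + _).
  rewrite (big_cat_nat (n := N)) //=; last by rewrite leq_addr.
  rewrite [X in _ + X]big_ltn; last by lia.
  rewrite fN add0r mulr2n mulrDl mul1r; congr (_ + _).
  rewrite -[N.+1]add1n big_addn addnK big_nat_rev.
  rewrite big_nat_cond [RHS]big_nat_cond; apply: eq_bigr => i /andP[/andP[i1 iN] _].
  by rewrite -f_sym; [congr f; lia | lia].
rewrite hj; exists (j + k%:Z - 1); rewrite /N; lia.
Qed.

End CmSumMod8.

(** * The sum of the CM curve modulo the characteristic *)

Section CentralBinomial.

Lemma logn_fact_wide (p n N : nat) : prime p -> (n <= N)%N ->
  logn p n`! = (\sum_(1 <= k < N.+1) n %/ p ^ k)%N.
Proof.
move=> pp nN; rewrite logn_fact // (big_cat_nat (n := n.+1) (p := N.+1)) //=.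
rewrite [X in (_ + X)%N]big_nat_cond [X in (_ + X)%N]big1 ?addn0 //.
move=> k /andP[/andP[nk _] _].
by rewrite divn_small // (leq_trans nk) // ltnW // ltn_expl // prime_gt1.
Qed.

(** All the base [p] digits of [a] are [(p - 1) / 4], so that no carry occurs in
    [a + a]; in Legendre's formula every quotient doubles. *)
Lemma central_binomial_ndvd (p r a : nat) :
  prime p -> (p %% 4 = 1)%N -> (4 * a + 1 = p ^ r)%N -> ~~ (p %| 'C(2 * a, a))%N.
Proof.
move=> pp p4 ar.
have pow4 k : exists u, (p ^ k = 4 * u + 1)%N.
  have : (p ^ k %% 4 = 1)%N by rewrite -modnXm p4 exp1n.
  by move=> h; exists (p ^ k %/ 4); rewrite {1}(divn_eq (p ^ k) 4) h mulnC.
have digit k : ((2 * a) %/ p ^ k = 2 * (a %/ p ^ k))%N.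
  have pk0 : (0 < p ^ k)%N by rewrite expn_gt0 prime_gt0.
  have [kr|rk] := leqP k r; last first.
    have : (p ^ r <= p ^ k)%N by rewrite leq_pexp2l ?prime_gt0 // ltnW.
    by move=> h; rewrite !divn_small //; lia.
  have := ar; rewrite -(subnK kr) expnD.
  have [u uE] := pow4 k; have [v ->] := pow4 (r - k)%N.
  rewrite uE => h; have -> : a = (v * (4 * u + 1) + u)%N by lia.
  rewrite mulnDr mulnA !divnMDl ?addn1 // !divn_small //; lia.
have aa : (a <= 2 * a)%N by lia.
have := congr1 (logn p) (bin_fact aa).
rewrite lognM ?bin_gt0 // ?lognM ?fact_gt0 ?muln_gt0 ?fact_gt0 //.
rewrite (_ : 2 * a - a = a)%N; last by lia.
rewrite (logn_fact_wide pp aa) (logn_fact_wide pp (leqnn (2 * a))).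
under [in RHS]eq_bigr => k _ do rewrite digit.
rewrite -big_distrr /= => h.
have l0 : logn p 'C(2 * a, a) = 0%N by lia.
apply/negP => pC; have : 0 < logn p 'C(2 * a, a).
  by rewrite logn_gt0 mem_primes pp bin_gt0 aa.
by rewrite l0.
Qed.

End CentralBinomial.

Section CmSumModP.
Local Open Scope ring_scope.

Lemma sum_expf (F : finFieldType) (e : nat) : (0 < e)%N ->
  \sum_(t : F) t ^+ e = if (#|F|.-1 %| e)%N then -1 else 0.
Proof.
move=> e0; case: ifPn => [/dvdnP[k ek]|Ne].
  rewrite (bigD1 (0 : F)) //= expr0n eqn0Ngt e0 add0r.
  rewrite (eq_bigr (fun=> 1)) => [|t t0]; last first.
    by rewrite ek mulnC exprM expf_pred // expr1n.
  rewrite sumr_const (cardC1 (0 : F)); apply/eqP; rewrite -addr_eq0 -mulrSr.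
  rewrite prednK ?(ltnW (finNzRing_gt1 F)) //.
  have [p pp pP] := finPcharP F; have := card_pprimeChar pP.
  rewrite /pPrimeCharType => cardF; rewrite -(dvdn_pcharf pP) cardF.
  apply: dvdn_exp => //; rewrite lt0n; apply: contraTneq (finNzRing_gt1 F) => n0.
  by rewrite cardF n0.
have [z zP] := finField_prim_root F.
have z0 : z != 0 by rewrite (prim_root_eq0 zP) -lt0n (prim_order_gt0 zP).
have ze : z ^+ e - 1 != 0 by rewrite subr_eq0 -(prim_order_dvd zP).
apply: (mulfI ze); rewrite mulr0 mulrBl mul1r; apply/eqP; rewrite subr_eq0; apply/eqP.
rewrite [RHS](reindex (fun t => z * t)) /=; last first.
  by exists (fun t => z^-1 * t) => t _; rewrite ?mulKf ?mulVKf.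
by rewrite mulr_sumr; apply: eq_bigr => t _; rewrite exprMn.
Qed.

(** By Euler's criterion [cm_sum F] is in [F] the sum of
    [(t ^ 3 + t) ^ (2 * a)], where the order of [F] is [4 * a + 1].  Of its
    monomials only [t ^ (4 * a)] has a nonzero sum over [F], so that [cm_sum F]
    is minus a central binomial coefficient. *)
Lemma cm_sum_ndvd (F : finFieldType) (p r : nat) :
  prime p -> (p %% 4 = 1)%N -> #|F| = (p ^ r)%N -> ~~ (p%:Z %| cm_sum F)%Z.
Proof.
move=> pp p4 cardF; have pF := card_finPcharP cardF pp.
have [a aF] : exists a, (4 * a + 1 = p ^ r)%N.
  have : (p ^ r %% 4 = 1)%N by rewrite -modnXm p4 exp1n.
  by move=> h; exists (p ^ r %/ 4)%N; rewrite {2}(divn_eq (p ^ r) 4) h mulnC.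
have oddF : odd #|F| by rewrite cardF -aF; lia.
have hF : (#|F|.-1./2 = 2 * a)%N by rewrite cardF -aF; lia.
have a0 : (0 < a)%N by have := halfQ_gt0 oddF; rewrite hF; lia.
rewrite (dvdz_pcharf pF) /cm_sum rmorph_sum /=.
under eq_bigr => t _ do rewrite qcharE // hF exprDn.
rewrite exchange_big /=.
have a2 : (a < (2 * a).+1)%N by lia.
rewrite (bigD1 (Ordinal a2)) //= [X in _ + X]big1 => [|i iN].
  rewrite addr0; under eq_bigr => t _ do rewrite -exprM -exprD.
  rewrite sumrMnl sum_expf; last by lia.
  rewrite cardF -aF ifT; last by apply/dvdnP; exists 1%N; lia.
  rewrite mulNrn oppr_eq0 -(dvdn_pcharf pF); exact: (central_binomial_ndvd pp p4 aF).
under eq_bigr => t _ do rewrite -exprM -exprD.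
have i2 := ltn_ord i.
rewrite sumrMnl sum_expf; last by lia.
rewrite ifF ?mul0rn //; apply/negP => /dvdnP[j].
rewrite cardF -aF => h; case/negP: iN; apply/eqP/val_inj => /=.
by case: j h => [|[|j]] h; lia.
Qed.

End CmSumModP.

(** * Sums of two squares *)

Section SumsOfTwoSquares.
Local Open Scope ring_scope.

(** The integers [c, d] are the real and imaginary parts of the [n]-th power of
    the Gaussian integer [x + i * y]. *)
Lemma gauss_pow_mod4 (x y : int) (n : nat) :
  (4 %| x - 1)%Z -> (2 %| y)%Z -> exists c d : int,
  [/\ (4 %| c - 1)%Z, (2 %| d)%Z, c ^+ 2 + d ^+ 2 = (x ^+ 2 + y ^+ 2) ^+ n &
  forall (E : fieldType) (i : E), i ^+ 2 = -1 ->
    c%:~R + i * d%:~R = (x%:~R + i * y%:~R) ^+ n].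
Proof.
move=> /dvdzP[u xE] /dvdzP[v yE].
elim: n => [|n [c [d [/dvdzP[s cE] /dvdzP[t dE] cd hE]]]].
  by exists 1, 0; split=> // E i _; rewrite expr0 mulr0z mulr0 addr0.
exists (c * x - d * y), (c * y + d * x); split.
- apply/dvdzP; exists (4 * s * u + s + u - t * v).
  have -> : c = s * 4 + 1 by lia.
  have -> : x = u * 4 + 1 by lia.
  by rewrite dE yE; ring.
- by apply/dvdzP; exists (c * v + t * x); rewrite dE yE; ring.
- by rewrite [RHS]exprS -cd; ring.
move=> E i iE; rewrite exprS -(hE E i iE) rmorphB rmorphD !rmorphM /=.
have -> : forall (a b u v : E), (u + i * v) * (a + i * b)
    = a * u + i ^+ 2 * (b * v) + i * (a * v + b * u).
  by move=> *; ring.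
by rewrite iE mulN1r.
Qed.

Lemma dvdz_Gauss_exp (p n : nat) (u v : int) : prime p ->
  ((p ^ n)%N%:Z %| u * v)%Z -> ~~ (p%:Z %| v)%Z -> ((p ^ n)%N%:Z %| u)%Z.
Proof.
move=> pp; rewrite !dvdzE abszM /= => h pv.
by move: h; rewrite Gauss_dvdl // coprimeXl // prime_coprime.
Qed.

Lemma primez_dvdM (p : nat) (u v : int) : prime p ->
  (p%:Z %| u * v)%Z = (p%:Z %| u)%Z || (p%:Z %| v)%Z.
Proof. by move=> pp; rewrite !dvdzE abszM /= Euclid_dvdM. Qed.

Lemma primez_dvd_sqr (p : nat) (u : int) : prime p ->
  (p%:Z %| u ^+ 2)%Z = (p%:Z %| u)%Z.
Proof. by move=> pp; rewrite expr2 primez_dvdM // orbb. Qed.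

(** Uniqueness of primitive representations.  From
    [(a * d - b * c) * (a * d + b * c) = p ^ n * (a ^ 2 - c ^ 2)], and because
    [p] cannot divide both factors, [p ^ n] divides one of them, say the first.
    Since [(a * c + b * d) ^ 2 + (a * d - b * c) ^ 2 = p ^ (2 * n)], that factor
    is 0 or [a * c + b * d] is; parity excludes the second case. *)
Lemma two_squares_uniq (p n : nat) (a b c d : int) :
  prime p -> odd p -> (0 < n)%N ->
  a ^+ 2 + b ^+ 2 = (p ^ n)%N%:Z -> c ^+ 2 + d ^+ 2 = (p ^ n)%N%:Z ->
  ~~ (p%:Z %| a)%Z -> ~~ (p%:Z %| c)%Z ->
  ~~ (2 %| a)%Z -> ~~ (2 %| c)%Z -> (2 %| b)%Z ->
  a ^+ 2 = c ^+ 2.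
Proof.
move=> pp oddp n0 ab cd pa pc a2 c2 b2.
(* Changing the sign of [d] exchanges the two factors. *)
wlog h : d cd / ((p ^ n)%N%:Z %| a * d - b * c)%Z.
  move=> H.
  have prodE : (a * d - b * c) * (a * d + b * c)
             = (p ^ n)%N%:Z * (a ^+ 2 - c ^+ 2).
    transitivity (a ^+ 2 * (c ^+ 2 + d ^+ 2) - c ^+ 2 * (a ^+ 2 + b ^+ 2)); first by ring.
    by rewrite ab cd; ring.
  have dv : ((p ^ n)%N%:Z %| (a * d - b * c) * (a * d + b * c))%Z.
    by rewrite prodE dvdz_mulr.
  have [h2|h2] := boolP (p%:Z %| a * d + b * c)%Z; last first.
    by apply: (H d) => //; apply: dvdz_Gauss_exp dv h2.
  apply: (H (- d)); first by rewrite sqrrN.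
  have -> : a * - d - b * c = - (a * d + b * c) by ring.
  rewrite dvdzE abszN -dvdzE; rewrite mulrC in dv.
  apply: dvdz_Gauss_exp dv _ => //; apply/negP => h1.
  have : (p%:Z %| 2 * a * d)%Z.
    rewrite (_ : 2 * a * d = (a * d - b * c) + (a * d + b * c)); last by ring.
    by rewrite rpredD.
  rewrite !primez_dvdM // (negPf pa) orbF => /orP[].
    by rewrite dvdzE /= dvdn_prime2 // => /eqP p2; rewrite p2 in oddp.
  move=> pd; case/negP: pc; rewrite -primez_dvd_sqr //.
  have -> : c ^+ 2 = (p ^ n)%N%:Z - d ^+ 2 by rewrite -cd addrK.
  by rewrite rpredB // ?primez_dvd_sqr // dvdzE /= dvdn_exp.
case/dvdzP: h => k hk.
have sum : (a * c + b * d) ^+ 2 + (a * d - b * c) ^+ 2 = (p ^ n)%N%:Z ^+ 2.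
  by rewrite [RHS]expr2 -{1}ab -cd; ring.
have P0 : 0 < (p ^ n)%N%:Z by rewrite ltz_nat expn_gt0 prime_gt0.
have [k0|k0] := eqVneq k 0.
  have h1 : (a * d) ^+ 2 = (b * c) ^+ 2.
    by move: hk; rewrite k0 mul0r => /eqP; rewrite subr_eq0 => /eqP->.
  apply: (mulfI (lt0r_neq0 P0)); rewrite -{1}cd -ab.
  by move: h1; rewrite !exprMn => h1; rewrite mulrDl mulrDl -h1; ring.
have sq0 : 0 <= (a * c + b * d) ^+ 2 by exact: sqr_ge0.
have k1 : 1 <= k ^+ 2 by rewrite -gtz0_ge1 lt0r sqrf_eq0 k0 sqr_ge0.
have kk : (a * c + b * d) ^+ 2 = (1 - k ^+ 2) * (p ^ n)%N%:Z ^+ 2.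
  by rewrite mulrBl mul1r -exprMn -hk -sum addrK.
have /eqP : (a * c + b * d) ^+ 2 = 0.
  apply/eqP; rewrite eq_le sq0 andbT kk mulr_le0_ge0 ?sqr_ge0 //.
  by rewrite subr_le0.
rewrite sqrf_eq0 addr_eq0 => /eqP acbd.
have : (2 %| a * c)%Z by rewrite acbd -mulNr dvdz_mulr // dvdzE abszN.
by rewrite (@primez_dvdM 2) // (negPf a2) (negPf c2).
Qed.

End SumsOfTwoSquares.

(** * The Frobenius trace of the CM curve *)

Section FrobeniusTrace.
Local Open Scope ring_scope.

Lemma int_parity (a : int) : exists u : int, a = 2 * u \/ a = 2 * u + 1.
Proof. by exists (a %/ 2)%Z; lia. Qed.

Lemma inert_dvd_two_squares (p : nat) (a b : int) :
  prime p -> (p %% 4 = 3)%N -> (p%:Z %| a ^+ 2 + b ^+ 2)%Z -> (p%:Z %| a)%Z.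
Proof.
move=> pp p4; have pF : p \in [pchar 'F_p] by exact: pchar_Fp.
have cardFp : #|'F_p| = p by rewrite card_Fp.
rewrite !(dvdz_pcharf pF) rmorphD !rmorphXn /= => /eqP ab.
apply/negP => /negP a0.
have hp : (p.-1 = 2 * (2 * (p %/ 4) + 1))%N by rewrite {1}(divn_eq p 4) p4; lia.
set x : 'F_p := a%:~R in ab a0 *; set y : 'F_p := b%:~R in ab *.
have y0 : y != 0.
  by apply: contraNneq a0 => y0; rewrite -sqrf_eq0 -ab y0 expr0n addr0.
have := expf_pred a0; rewrite cardFp hp exprM.
have -> : x ^+ 2 = - y ^+ 2 by apply/eqP; rewrite -addr_eq0 ab.
rewrite exprNn -signr_odd (_ : odd (2 * (p %/ 4) + 1)); last by lia.
have yp : y ^+ p.-1 = 1 by have := expf_pred y0; rewrite cardFp.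
rewrite -exprM -hp yp mulr1 => /eqP.
have := @neq1N1 'F_p; rewrite cardFp eq_sym => h; rewrite (negPf (h _)) //.
by rewrite (divn_eq p 4) p4; lia.
Qed.

(** Infinite descent: [p] divides both terms of a sum of two squares that it
    divides. *)
Lemma inert_two_squares (p m : nat) (a b : int) :
  prime p -> (p %% 4 = 3)%N -> a ^+ 2 + b ^+ 2 = (p ^ m)%N%:Z ^+ 2 ->
  exists2 s : int, a = s * (p ^ m)%N%:Z & s ^+ 2 <= 1.
Proof.
move=> pp p4; elim: m a b => [|m IHm] a b ab.
  exists a; rewrite ?expn0 ?mulr1 //; have := sqr_ge0 b.
  by move: ab; rewrite expn0 expr1n; lia.
have pab : (p%:Z %| a ^+ 2 + b ^+ 2)%Z.
  by rewrite ab expnS expr2 PoszM -!mulrA dvdz_mulr.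
have /dvdzP[a' aE] := inert_dvd_two_squares pp p4 pab.
rewrite addrC in pab.
have /dvdzP[b' bE] := inert_dvd_two_squares pp p4 pab.
have p0 : p%:Z ^+ 2 != 0 by rewrite sqrf_eq0 eqz_nat -lt0n prime_gt0.
have [|s sE s1] := IHm a' b'.
  apply: (mulfI p0); move: ab; rewrite aE bE expnS PoszM => ab.
  by rewrite -exprMn -ab; ring.
by exists s => //; rewrite aE sE expnSr PoszM mulrA.
Qed.

(** Jacobsthal's identity over the prime field. *)
Lemma prime_two_squares (p : nat) : prime p -> (p %% 4 = 1)%N ->
  exists x y : int, [/\ ~~ (2 %| x)%Z, (2 %| y)%Z & x ^+ 2 + y ^+ 2 = p%:Z].
Proof.
move=> pp p4; have cardFp : #|'F_p| = p by rewrite card_Fp.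
have oddFp : odd #|'F_p| by rewrite cardFp (divn_eq p 4) p4; lia.
have [|b hb] := jacobsthal oddFp.
  rewrite /qchar oppr_eq0 oner_eq0 cardFp.
  rewrite (_ : p.-1./2 = 2 * (p %/ 4))%N; last by rewrite {1}(divn_eq p 4) p4; lia.
  by rewrite exprM sqrrN !expr1n eqxx.
rewrite cardFp in hb; move: (cm_sum _) hb => a hb.
have [u ua] := int_parity a; have [v vb] := int_parity b.
have uv : u ^+ 2 + v ^+ 2 = p%:Z.
  by move: hb; case: ua => ->; case: vb => ->; lia.
have oddp : (p%:Z = 4 * (p %/ 4)%:Z + 1) by rewrite {1}(divn_eq p 4) p4; lia.
have ev (c : int) : (2 %| 2 * c)%Z by rewrite dvdz_mulr.
have od (c : int) : ~~ (2 %| 2 * c + 1)%Z.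
  by apply/negP => /dvdzP[k]; lia.
have [u' uu] := int_parity u; have [v' vv] := int_parity v.
case: uu uv => ->; case: vv => -> uv.
- by move: uv; rewrite oddp; lia.
- by exists (2 * v' + 1), (2 * u'); split; rewrite // addrC.
- by exists (2 * u' + 1), (2 * v'); split.
- by move: uv; rewrite oddp; lia.
Qed.

Lemma cm_sum_two_squares (p m : nat) (F : finFieldType) :
  prime p -> odd p -> (0 < m)%N -> #|F| = ((p ^ m) ^ 2)%N ->
  exists k b : int, [/\ cm_sum F = 2 * (4 * k + 3), (2 %| b)%Z &
    (4 * k + 3) ^+ 2 + b ^+ 2 = (p ^ m)%N%:Z ^+ 2].
Proof.
move=> pp oddp m0 cardF; have oddF := oddF_sq oddp cardF.
have [k hk] := cm_sum_mod8 pp oddp m0 cardF.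
have [b] := jacobsthal oddF (qchar_sqfieldN1 pp oddp m0 cardF).
rewrite hk cardF => hb; exists k.
have [v vb] := int_parity b.
have kv : (4 * k + 3) ^+ 2 + v ^+ 2 = (p ^ m)%N%:Z ^+ 2.
  by move: hb; move: (p ^ m)%N => P; case: vb => ->; lia.
exists v; split=> //; first by lia.
have [u [uv|uv]] := int_parity v; first by rewrite uv dvdz_mulr.
have [j Pj] : exists j : int, (p ^ m)%N%:Z = 2 * j + 1.
  have : odd (p ^ m) by rewrite oddX oddp orbT.
  by move: (p ^ m)%N => P; clear => oddP; exists (P./2%:Z); lia.
by move: kv; rewrite uv Pj; clear; lia.
Qed.

Lemma gauss_sqr (x y : int) (E : fieldType) (i : E) : i ^+ 2 = -1 ->
  (x ^+ 2 - y ^+ 2)%:~R + i * (2 * x * y)%:~R = (x%:~R + i * y%:~R) ^+ 2.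
Proof.
move=> iE; rewrite rmorphB !rmorphM /=.
transitivity (x%:~R ^+ 2 + i ^+ 2 * y%:~R ^+ 2 + 2 * i * x%:~R * y%:~R : E).
  by rewrite iE; ring.
by ring.
Qed.

(** If [p] divided the real part [c], it would divide [d] as well.  But modulo
    [p] the Gaussian integers map to the prime field by [i |-> - y / x], and
    this map sends [x + i * y] to [x - y ^ 2 / x = 2 * x], which is not 0. *)
Lemma gauss_pow_re_ndvd (p m : nat) (x y c d : int) :
  prime p -> odd p -> (0 < m)%N -> x ^+ 2 + y ^+ 2 = p%:Z ->
  c ^+ 2 + d ^+ 2 = (p ^ (2 * m))%N%:Z ->
  (forall (E : fieldType) (i : E), i ^+ 2 = -1 ->
     c%:~R + i * d%:~R = ((x%:~R + i * y%:~R) ^+ 2) ^+ m) ->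
  ~~ (p%:Z %| c)%Z.
Proof.
move=> pp oddp m0 xy cd hE.
apply/negP => pc; have pF : p \in [pchar 'F_p] by exact: pchar_Fp.
have pd : (p%:Z %| d)%Z.
  rewrite -primez_dvd_sqr // (_ : d ^+ 2 = (p ^ (2 * m))%N%:Z - c ^+ 2).
    by rewrite rpredB ?primez_dvd_sqr // dvdzE /= dvdn_exp // muln_gt0.
  by rewrite -cd addrC addKr.
have xF : (x%:~R : 'F_p) != 0.
  rewrite -(dvdz_pcharf pF); apply/negP => px.
  have py : (p%:Z %| y)%Z.
    rewrite -primez_dvd_sqr // (_ : y ^+ 2 = p%:Z - x ^+ 2).
      by rewrite rpredB ?primez_dvd_sqr.
    by rewrite -xy addrC addKr.
  have : ((p * p)%N%:Z %| p%:Z)%Z.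
    by rewrite -xy PoszM !expr2 rpredD // dvdz_mul.
  rewrite dvdzE /= -{3}[p]muln1 dvdn_pmul2l ?prime_gt0 // dvdn1 => /eqP p1.
  by rewrite p1 in pp.
have xyF : (x%:~R ^+ 2 + y%:~R ^+ 2 : 'F_p) = 0.
  by rewrite -!rmorphXn -rmorphD /= xy; apply/eqP; rewrite -(dvdz_pcharf pF).
have jE : (- (y%:~R / x%:~R) : 'F_p) ^+ 2 = -1.
  apply/eqP; rewrite sqrrN expr_div_n -addr_eq0.
  rewrite -(inj_eq (mulIf (expf_neq0 2 xF))).
  by rewrite mul0r mulrDl mul1r mulfVK ?expf_neq0 // addrC xyF.
have /esym/eqP := hE _ _ jE.
have -> : (c%:~R : 'F_p) = 0 by apply/eqP; rewrite -(dvdz_pcharf pF).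
have -> : (d%:~R : 'F_p) = 0 by apply/eqP; rewrite -(dvdz_pcharf pF).
rewrite mulr0 addr0 !expf_eq0 m0 /= => h.
have : (2 : 'F_p) * x%:~R ^+ 2 == 0.
  rewrite (_ : 2 * x%:~R ^+ 2
             = x%:~R * (x%:~R + - (y%:~R / x%:~R) * y%:~R)
               + (x%:~R ^+ 2 + y%:~R ^+ 2)).
    by rewrite (eqP h) mulr0 xyF addr0.
  by field.
rewrite mulf_eq0 sqrf_eq0 (negPf xF) orbF; apply/negP; apply: natf2_neq0.
by rewrite card_Fp.
Qed.

(** Half of [cm_sum F] and the real part [c] of [(x + i * y) ^ (2 * m)] both
    belong to primitive representations of [p ^ (2 * m)], so that they agree up
    to sign; the sign follows from their residues 3 and 1 modulo 4. *)
Lemma cm_sum_split_prime (p m : nat) (F : finFieldType) (x y : int)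
    (E : fieldType) (i : E) :
  prime p -> (p %% 4 = 1)%N -> (0 < m)%N -> #|F| = ((p ^ m) ^ 2)%N ->
  ~~ (2 %| x)%Z -> (2 %| y)%Z -> x ^+ 2 + y ^+ 2 = p%:Z -> i ^+ 2 = -1 ->
  (cm_sum F)%:~R
    = - (((x%:~R + i * y%:~R) ^+ 2) ^+ m + ((x%:~R - i * y%:~R) ^+ 2) ^+ m).
Proof.
move=> pp p4 m0 cardF x2 y2 xy iE.
have oddp : odd p by rewrite (divn_eq p 4) p4; lia.
have [k [b [hk b2 kb]]] := cm_sum_two_squares pp oddp m0 cardF.
have X4 : (4 %| x ^+ 2 - y ^+ 2 - 1)%Z.
  have [u [ux|ux]] := int_parity x; first by case/negP: x2; rewrite ux dvdz_mulr.
  case/dvdzP: y2 => v yv; apply/dvdzP; exists (u ^+ 2 + u - v ^+ 2).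
  by rewrite ux yv; ring.
have Y2 : (2 %| 2 * x * y)%Z by rewrite -mulrA dvdz_mulr.
have [c [d [c4 d2 cd hE]]] := gauss_pow_mod4 m X4 Y2.
have {}hE (K : fieldType) (j : K) : j ^+ 2 = -1 ->
    c%:~R + j * d%:~R = ((x%:~R + j * y%:~R) ^+ 2) ^+ m.
  by move=> jE; rewrite hE // gauss_sqr.
have powE : (p ^ (2 * m))%N%:Z = (p ^ m)%N%:Z ^+ 2 by rewrite mulnC expnM; lia.
have {}cd : c ^+ 2 + d ^+ 2 = (p ^ (2 * m))%N%:Z.
  rewrite cd (_ : _ + _ = p%:Z ^+ 2); last by rewrite -xy; ring.
  by rewrite -exprM; lia.
have pc := gauss_pow_re_ndvd pp oddp m0 xy cd hE.
have ac : (4 * k + 3) ^+ 2 = c ^+ 2.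
  apply: (two_squares_uniq (n := (2 * m)%N) pp oddp _ _ cd _ pc _ _ b2).
  - by rewrite muln_gt0.
  - by rewrite powE.
  - have : ~~ (p%:Z %| cm_sum F)%Z.
      by apply: (cm_sum_ndvd (r := (m * 2)%N) pp p4); rewrite cardF expnM.
    by apply: contra => ?; rewrite hk dvdz_mull.
  - by apply/negP => /dvdzP[t]; clear; lia.
  by case/dvdzP: c4 => u cu; apply/negP => /dvdzP[t]; clear -cu; lia.
have -> : cm_sum F = - (2 * c).
  case/dvdzP: c4 => u cu; rewrite hk; move/eqP: ac; rewrite eqf_sqr.
  by case/orP => /eqP; clear -cu; lia.
have iN : (- i) ^+ 2 = -1 by rewrite sqrrN.
have -> : x%:~R - i * y%:~R = x%:~R + (- i) * y%:~R by rewrite mulNr.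
by rewrite -(hE _ _ iE) -(hE _ _ iN) rmorphN rmorphM /=; ring.
Qed.

(** Both squares are divisible by [p ^ (2 * m)], so that half of the sum is
    [p ^ m] up to sign, and the sign is determined modulo 4 because
    [- p] is 1 modulo 4. *)
Lemma cm_sum_inert_prime (p m : nat) (F : finFieldType) :
  prime p -> (p %% 4 = 3)%N -> (0 < m)%N -> #|F| = ((p ^ m) ^ 2)%N ->
  cm_sum F = - (2 * (- p%:Z) ^+ m).
Proof.
move=> pp p4 m0 cardF.
have oddp : odd p by rewrite (divn_eq p 4) p4; lia.
have [k [b [hk _ kb]]] := cm_sum_two_squares pp oddp m0 cardF.
have [s sE s1] := inert_two_squares pp p4 kb.
have [t tE] : exists t : int, (- p%:Z) ^+ m = 4 * t + 1.
  elim: (m) => [|r [t tE]]; first by exists 0.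
  exists (- p%:Z * t - (p %/ 4)%:Z - 1); rewrite exprS tE.
  have -> : p%:Z = 4 * (p %/ 4)%:Z + 3 by rewrite {1}(divn_eq p 4) p4; lia.
  by ring.
rewrite hk tE; move: sE.
have -> : (p ^ m)%N%:Z = (-1) ^+ m * (- p%:Z) ^+ m.
  by rewrite -exprMn mulN1r opprK; lia.
rewrite tE; have [->|[->|->]] : s = 0 \/ s = 1 \/ s = -1 by nia.
- by rewrite mul0r; lia.
- by rewrite mul1r -signr_odd; case: (odd m); rewrite ?expr0 ?expr1; lia.
- by rewrite -signr_odd; case: (odd m); rewrite ?expr0 ?expr1; lia.
Qed.

(** Here [w] and [w'] are the eigenvalues of the square of Frobenius on the CM
    curve over the prime field, read in an arbitrary field [E] that contains a
    square root of -1.  They are [- p] twice in the supersingular case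
    [p = 3] modulo 4, and the squares of [x + i * y] and [x - i * y] otherwise,
    where [p = x ^ 2 + y ^ 2]. *)
Lemma cm_sum_trace (p : nat) (E : fieldType) (i : E) :
  prime p -> odd p -> i ^+ 2 = -1 -> exists w w' : E, w * w' = p%:R ^+ 2 /\
  forall (m : nat) (F : finFieldType), (0 < m)%N -> #|F| = ((p ^ m) ^ 2)%N ->
    (cm_sum F)%:~R = - (w ^+ m + w' ^+ m).
Proof.
move=> pp oddp iE.
have [p4|p4] : (p %% 4 = 1)%N \/ (p %% 4 = 3)%N by lia.
  have [x [y [x2 y2 xy]]] := prime_two_squares pp p4.
  exists ((x%:~R + i * y%:~R) ^+ 2), ((x%:~R - i * y%:~R) ^+ 2); split.
    rewrite -exprMn; congr (_ ^+ 2).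
    transitivity (x%:~R ^+ 2 - i ^+ 2 * y%:~R ^+ 2 : E); first by ring.
    by rewrite iE mulN1r opprK -!rmorphXn -rmorphD /= xy.
  by move=> m F m0 cardF; exact: cm_sum_split_prime pp p4 m0 cardF x2 y2 xy iE.
exists (- p%:R), (- p%:R); split; first by rewrite mulrNN -expr2.
move=> m F m0 cardF; rewrite (cm_sum_inert_prime pp p4 m0 cardF).
by rewrite rmorphN rmorphM rmorphXn rmorphN /=; ring.
Qed.

End FrobeniusTrace.

(** * The exponents of maximality *)

Section MaximalityExponent.
Local Open Scope ring_scope.

(** If [m] had the smaller valuation, then for [m'] the odd part of [m] the
    exponent [n * m'] would be both an odd multiple of [n] and an even multiple
    of [m]. *)
Lemma expf_eqN1_logn2 (E : fieldType) (x : E) (m n : nat) : (1 : E) != -1 ->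
  (0 < m)%N -> (0 < n)%N -> x ^+ m = -1 -> x ^+ n = -1 -> logn 2 m = logn 2 n.
Proof.
move=> E2; wlog: m n / (logn 2 m < logn 2 n)%N => [H m0 n0 xm xn|mn m0 n0 xm xn].
  have [h|h|//] := ltngtP (logn 2 m) (logn 2 n); first exact: H.
  by apply/esym/H.
have [m' m2 mE] := pfactor_coprime (isT : prime 2) m0.
have := pfactor_dvdnn 2 n => /dvdnP[n' nE].
have h1 : x ^+ (n * m') = -1.
  by rewrite exprM xn -signr_odd; move: m2; rewrite coprime2n => ->.
have h2 : x ^+ (n * m') = 1.
  have -> : (n * m' = m * (2 * (n' * 2 ^ (logn 2 n - (logn 2 m).+1))))%N.
    rewrite [X in (X * _ = _)%N]nE [X in (_ = X * _)%N]mE.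
    rewrite -{1}(subnK mn) expnD expnS.
    by move: (2 ^ _)%N (2 ^ _)%N => u v; clear; lia.
  by rewrite exprM xm exprM sqrrN !expr1n.
by case/eqP: E2; rewrite -h1 h2.
Qed.

Lemma field_sqrtN1 (l : nat) : prime l ->
  exists (E : fieldType) (i : E), l \in [pchar E] /\ i ^+ 2 = -1.
Proof.
move=> pl; pose q : {poly 'F_l} := 'X^2 + 1.
have sq : size q = 3%N by rewrite /q size_polyDl size_polyXn // size_poly1.
have q0 : q != 0 by rewrite -size_poly_eq0 sq.
have [E [rs qrs _]] := FinSplittingFieldFor q0.
have : size (map_poly (in_alg E) q) = 3%N by rewrite size_map_poly sq.
rewrite (eqp_size qrs) size_prod_XsubC.
case: rs qrs => // i rs qrs _; exists E, i; split.
  exact: (rmorph_pchar (in_alg E) (pchar_Fp pl)).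
have /rootP : root (map_poly (in_alg E) q) i.
  by rewrite (eqp_root qrs) root_prod_XsubC mem_head.
rewrite /q rmorphD rmorph1 /= map_polyXn !hornerE => /eqP.
by rewrite addr_eq0 => /eqP.
Qed.

(** Put [q = p ^ m].  In characteristic [l] one has [w ^ m * w' ^ m = q ^ 2] and
    [w ^ m + w' ^ m = -2 * q] or [2 * q], so that both powers are [- q] in the
    first case and [q] in the second.  The value of [q ^ 2] is 1 in the first
    case and -1 in the second: multiplying by [q] gives -1 both times. *)
Lemma maximal_exponent (p l d m : nat) (F : finFieldType)
    (E : fieldType) (w w' : E) :
  odd p -> odd d -> (1 < d)%N -> (l %| d)%N -> l \in [pchar E] ->
  w * w' = p%:R ^+ 2 -> (cm_sum F)%:~R = - (w ^+ m + w' ^+ m) ->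
  maximal_over F d (p ^ m) -> (w * p%:R) ^+ m = -1.
Proof.
move=> oddp oddd d1 ld lE ww' wF hmax.
have oddq : odd (p ^ m) by rewrite oddX oddp orbT.
have d0 : (d%:R : E) = 0 by apply/eqP; rewrite -(dvdn_pcharf lE).
have dz (a : int) : (d%:Z %| a)%Z -> (a%:~R : E) = 0.
  by case/dvdzP => k ->; rewrite rmorphM /= -[d%:~R]pmulrn d0 mulr0.
have dn (a : nat) : (d %| a)%N -> (a%:R : E) = 0.
  by case/dvdnP => k ->; rewrite natrM d0 mulr0.
have pm : w ^+ m * w' ^+ m = (p%:R ^+ m) ^+ 2 by rewrite -exprMn ww' exprAC.
have q0 : (0 < p ^ m)%N by case: (p ^ m)%N oddq.
rewrite exprMn; set P : E := p%:R ^+ m in pm *.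
have PE : ((p ^ m)%N%:R : E) = P by rewrite natrX.
have [[hd hs]|[hd hs]] := maximal_congruence oddd d1 oddq hmax.
- have P2 : P ^+ 2 = 1.
    have := dn _ hd; rewrite -subn1 natrB; last by rewrite expn_gt0 q0.
    rewrite natrX PE => /eqP.
    by rewrite subr_eq0 => /eqP.
  have := dz _ hs; rewrite rmorphB /= wF -[(2 * _)%N%:~R]pmulrn natrM PE => h.
  have /eqP : (w ^+ m + P) ^+ 2 = 0.
    transitivity (P ^+ 2 - w ^+ m * w' ^+ m
                  - w ^+ m * (- (w ^+ m + w' ^+ m) - 2 * P)); first by ring.
    by rewrite h pm subrr mulr0 subr0.
  rewrite sqrf_eq0 addr_eq0 => /eqP->.
  by rewrite mulNr -expr2 P2.
- have P2 : P ^+ 2 = -1.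
    have := dn _ hd; rewrite -addn1 natrD natrX PE => /eqP.
    by rewrite addr_eq0 => /eqP.
  have := dz _ hs; rewrite rmorphD /= wF -[(2 * _)%N%:~R]pmulrn natrM PE => h.
  have /eqP : (w ^+ m - P) ^+ 2 = 0.
    transitivity (P ^+ 2 - w ^+ m * w' ^+ m
                  - w ^+ m * (- (w ^+ m + w' ^+ m) + 2 * P)); first by ring.
    by rewrite h pm subrr mulr0 subr0.
  rewrite sqrf_eq0 subr_eq0 => /eqP->.
  by rewrite -expr2 P2.
Qed.

Lemma maximal_same_logn2 (p l d d' m n : nat) (F F' : finFieldType) :
  prime p -> odd p -> prime l -> odd d -> odd d' -> (1 < d)%N -> (1 < d')%N ->
  (l %| d)%N -> (l %| d')%N -> (0 < m)%N -> (0 < n)%N ->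
  maximal_over F d (p ^ m) -> maximal_over F' d' (p ^ n) -> logn 2 m = logn 2 n.
Proof.
move=> pp oddp pl oddd oddd' d1 d1' ld ld' m0 n0 hF hF'.
have [E [i [lE iE]]] := field_sqrtN1 pl.
have [w [w' [ww' hw]]] := cm_sum_trace pp oddp iE.
have E2 : (1 : E) != -1.
  rewrite -addr_eq0 -[1 + 1]/(2%:R : E) -(dvdn_pcharf lE).
  have oddl := dvdn_odd ld oddd; rewrite dvdn_prime2 //.
  by apply: contraTneq oddl => ->.
have hm : (w * p%:R) ^+ m = -1.
  apply: (maximal_exponent oddp oddd d1 ld lE ww' _ hF).
  by apply: hw => //; case: hF.
have hn : (w * p%:R) ^+ n = -1.
  apply: (maximal_exponent oddp oddd' d1' ld' lE ww' _ hF').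
  by apply: hw => //; case: hF'.
exact: expf_eqN1_logn2 E2 m0 n0 hm hn.
Qed.

End MaximalityExponent.

Theorem lemma4p2p2 (l1 l2 p m n : nat) (K1 K2 : finFieldType)
  (hl1 : prime l1) (ol1 : odd l1) (hl2 : prime l2) (ol2 : odd l2)
  (hl12 : l1 <> l2) (hp : prime p) (hpl : ~~ (p %| 2 * l1 * l2))
  (hm : 0 < m) (hn : 0 < n)
  (max1 : maximal_over K1 l1 (p ^ m))
  (max2 : maximal_over K2 l2 (p ^ n))
  (max12 : exists (k : nat) (K : finFieldType),
     0 < k /\ maximal_over K (l1 * l2) (p ^ k)) :
  logn 2 n = logn 2 m.
Proof.
have [k [K [k0 maxK]]] := max12.
have oddp : odd p.
  apply: contraNT hpl; case: (even_prime hp) => [->|->] // _.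
  by rewrite -mulnA dvdn_mulr.
have ol : odd (l1 * l2) by rewrite oddM ol1.
have l_gt1 : 1 < l1 * l2.
  by rewrite (leq_trans (prime_gt1 hl1)) // leq_pmulr // prime_gt0.
transitivity (logn 2 k).
  apply: (maximal_same_logn2 hp oddp hl2 ol2 ol _ l_gt1 _ _ hn k0 max2 maxK) => //.
    exact: prime_gt1.
  exact: dvdn_mull.
apply/esym/(maximal_same_logn2 hp oddp hl1 ol1 ol _ l_gt1 _ _ hm k0 max1 maxK) => //.
  exact: prime_gt1.
exact: dvdn_mulr.
Qed.
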